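(* Let $p$ and $q$ be primes and let $G$ be a finite group that is both $p$-solvable and $q$-solvable. Then: (B) If $p$ and $q$ both divide $|G|$ and $\mathrm{Irr}_{p'}(B_p(G))=\mathrm{Irr}_{q'}(B_q(G))$, then $p=q$. (C) If $p\neq q$, then the following are equivalent: (i) $q$ does not divide $\chi(1)$ for all $\chi\in \mathrm{Irr}_{p'}(B_p(G))$ and $p$ does not divide $\chi(1)$ for all $\chi\in\mathrm{Irr}_{q'}(B_q(G))$; (ii) there are a Sylow $p$-subgroup $P$ of $G$ and a Sylow $q$-subgroup $Q$ of $G$ such that $xy=yx$ for all $x\in P$ and $y\in Q$.
   Context: For a finite group $G$ and a prime $p$, $B_p(G)$ is the principal $p$-block of $G$ (the Brauer $p$-block containing the trivial character $1_G$). $\mathrm{Irr}_{p'}(B_p(G))$ is the set of irreducible complex characters $\chi$ of $G$ lying in $B_p(G)$ with $p\nmid\chi(1)$. *)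

(* Defs.v *)
From HB Require Import structures.
From mathcomp Require Import all_boot all_order all_fingroup all_algebra.
From mathcomp Require Import all_solvable all_field all_character.
From mathcomp Require boolp classical_sets.

Set Implicit Arguments.
Unset Strict Implicit.
Unset Printing Implicit Defensive.

Import GRing.Theory Num.Theory.

Local Open Scope ring_scope.

Record algint := AlgInt { algint_val :> algC; algint_valP : algint_val \in Aint }.

HB.instance Definition _ := [isSub for algint_val].
HB.instance Definition _ := [Choice of algint by <:].
HB.instance Definition _ := [SubChoice_isSubComNzRing of algint by <:].

(* [idealr_closed] includes properness (1 \notin I). *)
Definition maximal_ideal (R : comNzRingType) (M : {pred R}) : Prop :=
  idealr_closed M /\
  forall I : {pred R}, idealr_closed I -> {subset M <= I} -> {subset I <= M}.

Definition maximal_ideal_over (p : nat) (M : {pred algint}) : Prop :=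
  maximal_ideal M /\ p%:R \in M.

Lemma maximal_ideal_over_exists (p : nat) :
  prime p -> exists M, maximal_ideal_over p M.
Proof.
move=> p_pr.
pose P (X : algint -> Prop) :=
  [/\ forall a u v, X u -> X v -> X (a * u + v), ~ X 1
    & (exists u, X u) -> X p%:R].
have PpA : P (fun z => exists a, z = a * p%:R).
  split=> [a _ _ [b ->] [c ->] | [a Da] | _]; last by exists 1; rewrite mul1r.
    by exists (a * b + c); rewrite mulrDl mulrA.
  have {}Da : 1 = val a * p%:R.
    by move/(congr1 val): Da; rewrite rmorphM rmorph_nat rmorph1.
  have nz_p : p%:R != 0 :> algC by rewrite pnatr_eq0 -lt0n prime_gt0.
  have Dva : val a = p%:R^-1 by rewrite -(mulfK nz_p (val a)) -Da mul1r.
  have /Cint_rat_Aint/(_ (valP a)) : val a \in Crat by rewrite Dva rpredV rpred_nat.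
  rewrite intrEge0 ?Dva ?invr_ge0 ?ler0n // -Dva => /natrP[n Dn].
  have /eqP : (1 = n * p)%N by apply/eqP; rewrite -eqC_nat natrM -Dn -Da.
  by rewrite eq_sym muln_eq1 => /andP[_ /eqP p1]; rewrite p1 in p_pr.
have [F FP totF | A [[AI A1 Ap] maxA]] := @classical_sets.Zorn_bigcup algint P.
  split=> [a u v [X FX Xu] [Y FY Yv] | [X FX X1] | [u [X FX Xu]]].
  - have [sXY | sYX] := totF X Y FX FY.
      by exists Y => //; have [YI _ _] := FP Y FY; apply: YI => //; apply: sXY.
    by exists X => //; have [XI _ _] := FP X FX; apply: XI => //; apply: sYX.
  - by have [_ X1F _] := FP X FX; apply: X1F.
  - by exists X => //; have [_ _] := FP X FX; apply; exists u.
have [u Au] : exists u, A u.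
  apply: boolp.contrapT => noA; apply: (maxA _ _ PpA).
  split=> [z Az | sAp]; first by exfalso; apply: noA; exists z.
  by apply: noA; exists p%:R; apply: sAp; exists 1; rewrite mul1r.
have A0 : A 0 by rewrite -[0](addNr u) -mulN1r; apply: AI.
have {}Ap : A p%:R by apply: Ap; exists u.
exists (fun z => boolp.asbool (A z)); split; last exact/boolp.asboolP.
split=> [|I [I0 I1 II] sAI z Iz].
  split=> [||a x y /boolp.asboolP Ax /boolp.asboolP Ay]; first exact/boolp.asboolP.
    by apply/negP=> /boolp.asboolP.
  exact/boolp.asboolP/AI.
apply/boolp.asboolP; apply: boolp.contrapT => nAz.
apply: (maxA (fun x => x \in I)).
  by split=> [x Ax | sIA]; [apply/sAI/boolp.asboolP | apply/nAz/sIA].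
split=> [a x y Ix Iy | /idP | _]; first exact: II.
  by rewrite (negPf I1).
exact/sAI/boolp.asboolP.
Qed.

Section Blocks.

Variables (gT : finGroupType) (G : {group gT}).

(* The value |K| chi_i(x) / chi_i(1), x \in K, of the central character of     *)
(* chi_i at the sum of the k-th conjugacy class K of G.                       *)
Definition omega (i : Iirr G) (k : 'I_#|classes G|) : algint :=
  AlgInt (Aint_gring_mode_class_sum i k).

(* When M is a maximal ideal of the algebraic integers with p \in M, this is  *)
(* the relation of lying in the same Brauer p-block of G; the partition of    *)
(* Irr(G) into p-blocks does not depend on the choice of M.                   *)
Definition same_block (M : {pred algint}) (i j : Iirr G) : bool :=
  [forall k, omega i k - omega j k \in M].

(* 'chi_0 is the trivial character of G. *)
Definition principal_block (M : {pred algint}) : {set Iirr G} :=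
  [set i | same_block M i 0].

Definition Irr_p'_principal (p : nat) (M : {pred algint}) : {set Iirr G} :=
  [set i in principal_block M | ~~ (p %| 'chi_i 1%g)%C].

(* G has a normal series 1 = N_0 <= ... <= N_r = G, all N_j normal in G,      *)
(* each of whose factors is a p-group or a p'-group.                          *)
Definition p_solvable (p : nat) : Prop :=
  exists2 s : seq {group gT},
    path [rel V U : {group gT} |
           invariant_factor G V U && (p.-group (U / V) || p^'.-group (U / V))%g]
         1%G s
    & last 1%G s = G.

End Blocks.

Arguments principal_block {gT} G M.
Arguments Irr_p'_principal {gT} G p M.
Arguments p_solvable {gT} G p.

(* Main.v *)
(* For a p-solvable group G the p'-degree characters of the principal p-block *)
(* are those with 'O_p^'(G) in their kernel: if |x ^: G| is prime to p then x *)
(* centralises a Sylow p-subgroup, so by Hall-Higman x is a p-element modulo  *)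
(* 'O_p^'(G); otherwise the central characters vanish at x ^: G.              *)
(*   The heart of the proof is a theorem of Navarro and Wolf: if every        *)
(* irreducible character of p'-degree has q'-degree, then 'N_G(P) is          *)
(* contained in 'N(Q) for some Sylow subgroups P and Q.  It follows by        *)
(* induction along a minimal normal subgroup N.  When N is a {p, q}'-group    *)
(* one compares P-invariant and Q-invariant characters of N through the       *)
(* Glauberman correspondence; when N is a p-group one uses linear characters  *)
(* of P.  Applied to G / 'O_p^'(G), where 'O_p is self-centralising and       *)
(* normalises Q, it shows that (i) makes G / 'O_p^'(G) a q'-group and         *)
(* G / 'O_q^'(G) a p'-group, which is equivalent to (ii); for (B), every      *)
(* Sylow p-subgroup would lie in 'O_q^'(G), hence in the kernel of all the    *)
(* p'-degree characters of G / 'O_p^'(G).                                     *)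

Require Import Defs.
From mathcomp Require Import all_boot all_order all_fingroup all_algebra.
From mathcomp Require Import all_solvable all_field all_character.
From mathcomp Require Import ring.

Set Implicit Arguments.
Unset Strict Implicit.
Unset Printing Implicit Defensive.
Import GroupScope GRing.Theory Num.Theory.

(** * Congruences between algebraic integers *)

Local Open Scope ring_scope.

(** The lemmas carry the argument as follows. [principal_block_cfker] and [mem_principal_block]
    identify Irr_p'(B_p(G)) with the p'-degree characters of G / O_p'(G), so (i) becomes a condition
    on degrees in two quotients. [norm_Sylow_p'irr_q'] turns it into a Sylow normaliser inclusion,
    [q'group_quotient_core] into q not dividing |G / O_p'(G)|, and [commuting_Sylows_exist] into
    commuting Sylow subgroups. The Glauberman-type counting behind [cent_sub_invariant_irr] is done
    by reducing orthogonality relations modulo p, where only the fixed points of a p-group survive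
    ([sum_fix_eqAmod]). *)

Lemma dvdA_mull (p : nat) (x y : algC) :
  y \in Aint -> (p %| x)%A -> (p %| y * x)%A.
Proof. by move=> Ay; rewrite -!eqAmod0 => /(eqAmodMl Ay); rewrite mulr0. Qed.

Lemma dvdA_sum (p : nat) (I : Type) (r : seq I) (P : pred I) (F : I -> algC) :
  (forall i, P i -> (p %| F i)%A) -> (p %| \sum_(i <- r | P i) F i)%A.
Proof. exact: rpred_sum. Qed.

Lemma dvdA_pmul2l (p m : nat) (x : algC) :
  (0 < m)%N -> coprime m p -> x \in Aint -> (p %| m%:R * x)%A -> (p %| x)%A.
Proof.
move=> m_gt0 /eqP co_mp Ax p_mx; have [u v Duv _] := egcdnP p m_gt0.
have ->: x = u%:R * (m%:R * x) - v%:R * (p%:R * x).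
  by rewrite !mulrA -!natrM Duv co_mp -mulrBl -natrB ?leq_addr // addKn mul1r.
rewrite rpredB // dvdA_mull ?Aint_Cnat //.
by rewrite -eqAmod0 eqAmodMr0.
Qed.

Lemma det_eqAmod (p n : nat) (A A' : 'M[algC]_n) :
    (forall i j, A i j \in Aint) -> (forall i j, A' i j \in Aint) ->
    (forall i j, A i j == A' i j %[mod p])%A ->
  (\det A == \det A' %[mod p])%A.
Proof.
move=> intA intA' eqAA'; rewrite /eqAmod -sumrB dvdA_sum // => s _.
rewrite -mulrBr dvdA_mull ?rpredX ?rpredN ?rpred1 //.
suffices [_ _]: [/\ \prod_i A i (s i) \in Aint, \prod_i A' i (s i) \in Aint
  & (\prod_i A i (s i) == \prod_i A' i (s i) %[mod p])%A] by [].
elim/big_ind2: _ => [|x1 y1 x2 y2 [A1 A2 e12] [B1 B2 f12]|i _]; split => //.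
- exact: rpredM.
- exact: rpredM.
- exact: eqAmodM.
Qed.

(* The congruence makes det (Y *m X) prime to p, hence Y *m X has rank #|B|.  *)
Lemma leq_card_gram_mod (p : nat) (T U : finType) (A : {set T}) (B : {set U})
    (f : T -> U -> algC) (g : U -> T -> algC) (d : U -> nat) :
    prime p ->
    (forall a b, f a b \in Aint) -> (forall b a, g b a \in Aint) ->
    {in B, forall b, ~~ (p %| d b)%N} ->
    {in B &, forall b b', (\sum_(a in A) g b a * f a b'
                             == (d b)%:R *+ (b == b') %[mod p])%A} ->
  (#|B| <= #|A|)%N.
Proof.
move=> p_pr intf intg p'd gram.
pose X := \matrix_(i < #|A|, j < #|B|) f (enum_val i) (enum_val j).
pose Y := \matrix_(i < #|B|, j < #|A|) g (enum_val i) (enum_val j).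
pose D := diag_mx (\row_(i < #|B|) (d (enum_val i))%:R) : 'M[algC]_#|B|.
have detYX : (\det (Y *m X) == \det D %[mod p])%A.
  apply: det_eqAmod => i j; last first.
  - rewrite !mxE -(inj_eq enum_val_inj).
    rewrite (eq_bigr (fun k => g (enum_val i) (enum_val k) * f (enum_val k) (enum_val j))).
      rewrite -(big_enum_val (fun a => g (enum_val i) a * f a (enum_val j))).
      by apply: gram; apply: enum_valP.
    by move=> k _; rewrite !mxE.
  - by rewrite !mxE rpredMn // Aint_Cnat.
  - by rewrite !mxE rpred_sum // => k _; rewrite !mxE rpredM.
have nzYX : \det (Y *m X) != 0.
  apply: contraTneq detYX => ->; rewrite eqAmod_sym eqAmod0.
  rewrite det_diag (eq_bigr (fun i => (d (enum_val i))%:R)) => [|i _]; last by rewrite mxE.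
  rewrite -natr_prod -eqAmod0 eqAmod0_nat Euclid_dvd_prod //.
  by rewrite big_has; apply/hasPn=> i _; apply/p'd/enum_valP.
have: Y *m X \in unitmx by rewrite unitmxE unitfE.
by rewrite -row_free_unit => /eqP <-; apply: leq_trans (mxrankM_maxr _ _) (rank_leq_row _).
Qed.

(** A weighted fixed-point congruence: [F] is constant on orbits, and every nontrivial orbit has
    size divisible by p. It is applied to sums over elements as well as over characters. *)
Lemma sum_fix_eqAmod (aT : finGroupType) (sT : finType) (D : {group aT})
    (to : action D sT) (p : nat) (G : {group aT}) (S : {set sT}) (F : sT -> algC) :
    p.-group G -> [acts G, on S | to] -> (forall x, F x \in Aint) ->
    {in S & G, forall x a, F (to x a) = F x} ->
  (\sum_(x in S) F x == \sum_(x in 'Fix_(S | to)(G)) F x %[mod p])%A.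
Proof.
move=> pG nSG intF invF; have sGD := acts_dom nSG.
rewrite (big_setID 'Fix_to(G)) /= -[X in (_ == X %[mod p])%A]addr0 eqAmodDl.
set S' := S :\: _; have nS'G : [acts G, on S' | to].
  rewrite actsD // -(setIidPr sGD); apply: subset_trans (acts_subnorm_fix _ _).
  by rewrite setIS ?normG.
have partS' := orbit_partition nS'G.
rewrite eqAmod0 (set_partition_big _ partS') dvdA_sum //=.
move=> _ /imsetP[x S'x ->]; have [Sx nFx] := setDP S'x.
rewrite (eq_bigr (fun=> F x)) => [|y /orbitP[a Ga <-]]; last exact: invF.
rewrite sumr_const -mulr_natl mulrC dvdA_mull //.
rewrite -eqAmod0 eqAmod0_nat.
have [k oGx]: {k | #|orbit to G x| = (p ^ k)%N}.
  by apply: p_natP; apply: pnat_dvd pG; rewrite card_orbit_in ?dvdn_indexg.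
case: k oGx => [/card_orbit1 fix_x | k ->]; last by rewrite expnS dvdn_mulr.
by case/afixP: nFx => a Ga; apply/set1P; rewrite -fix_x mem_orbit.
Qed.

(** * Coprime action of a p-group: invariant characters *)

(** Jordan's argument: at most |G : A| conjugates of [A^#], each of size |A| - 1, cover [G^#], so
    |G| - 1 is at most |G| - |G : A|. *)
Lemma class_support_eqG (gT : finGroupType) (A G : {group gT}) :
  A \subset G -> G \subset class_support A G -> G :=: A.
Proof.
move=> sAG sGAG; apply/eqP; rewrite eqEsubset sAG andbT -indexg_eq1.
rewrite eqn_leq indexg_gt0 andbT.
have := (leq_card_cover (A^# :^: G)).1.
rewrite -class_supportD1 (eq_bigr (fun=> #|A|.-1)) => [|_ /imsetP[x _ ->]]; last first.
  by rewrite cardJg (cardsD1 1%g A) group1.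
rewrite sum_nat_const card_conjugates.
have le_iN : (#|G : 'N_G(A^#)| <= #|G : A|)%N.
  apply: dvdn_leq => //. apply: indexgS.
  by rewrite subsetI sAG; apply: normsD1; apply: normG.
move=> le_G1; have {le_G1 le_iN}: (#|G^#| <= #|G : A| * #|A|.-1)%N.
  apply: leq_trans (subset_leq_card (setSD _ sGAG)) (leq_trans le_G1 _).
  by rewrite leq_mul2r le_iN orbT.
have Dn : (#|G : A| * #|A|.-1 + #|G : A| = #|G^#|.+1)%N.
  by rewrite -mulnSr prednK // mulnC Lagrange // (cardsD1 1%g G) group1.
by move=> leG1; rewrite -(leq_add2l (#|G : A| * #|A|.-1)) Dn addn1 ltnS.
Qed.

Section CoprimeAction.

Variables (gT : finGroupType) (N : {group gT}).

Fact conjg_Iirr_is_action : is_action 'N(N) (@conjg_Iirr gT N).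
Proof.
split=> [a | i a b nNa nNb]; first exact: conjg_Iirr_inj.
by apply: irr_inj; rewrite !conjg_IirrE (cfConjgM _ (normalG N)).
Qed.

Definition conjg_Iirr_action := Action conjg_Iirr_is_action.

Definition invariant_irr (A : {set gT}) : {set Iirr N} :=
  [set i | A \subset 'I['chi_i]].

Lemma afix_conjg_Iirr (A : {set gT}) :
  A \subset 'N(N) -> 'Fix_conjg_Iirr_action(A) = invariant_irr A.
Proof.
move=> nNA; apply/setP=> i; rewrite [in RHS]inE; apply/afixP/subsetP=> fix_i a Aa.
  rewrite inE (subsetP nNA) //= -conjg_IirrE; apply/eqP; congr ('chi__).
  exact: fix_i.
by apply: irr_inj; rewrite /= conjg_IirrE inertiaJ ?fix_i.
Qed.

Variables (p : nat) (P : {group gT}).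
Hypotheses (pP : p.-group P) (p'N : p^'.-group N) (nNP : P \subset 'N(N)).

Lemma prime_p'group : prime p -> ~~ (p %| #|N|)%N.
Proof. by move=> p_pr; rewrite -p'natE. Qed.

(** The elements of N conjugating [x] to [y] form a P-stable coset of ['C_N[x]]. Its size is prime
    to p, so P fixes one of them. *)
Lemma class_cent_pgroup x y :
  prime p -> x \in 'C_N(P) -> y \in 'C_N(P) -> y \in x ^: N -> y \in x ^: 'C_N(P).
Proof.
move=> p_pr /setIP[Nx cPx] /setIP[_ cPy] /imsetP[n Nn Dy].
pose S := [set m in N | (x ^ m)%g == y].
have nSP : [acts P, on S | 'J].
  apply/actsP=> a Pa m /=.
  have fixJ z : z \in 'C(P) -> (z ^ a)%g = z.
    by move/centP/(_ a Pa)/commgP/conjg_fixP.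
  rewrite !inE memJ_norm ?(subsetP nNP) //.
  by rewrite -{1}(fixJ x cPx) -conjJg -{1}(fixJ y cPy) (inj_eq (conjg_inj a)).
have oS : #|S| = #|'C_N[x]|.
  rewrite -(card_rcoset 'C_N[x] n); apply: eq_card => m.
  rewrite mem_rcoset in_setI [m \in _]inE groupMr ?groupV //; congr (_ && _).
  rewrite cent1C (sameP cent1P commgP) -conjg_fix conjgM Dy.
  by rewrite (can2_eq (conjgKV n) (conjgK n)).
have [m] : exists m, m \in 'Fix_(S | 'J)(P).
  apply/set0Pn; apply: contraNneq (prime_p'group p_pr) => fix0.
  have := pgroup_fix_mod pP nSP; rewrite fix0 cards0 oS mod0n => /eqP p_cN.
  exact: dvdn_trans p_cN (cardSg (subsetIl _ _)).
rewrite afixJ => /setIP[/setIdP[Nm /eqP <-] cPm].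
by rewrite imset_f // in_setI Nm.
Qed.

Lemma invariant_irrJ i x a :
  i \in invariant_irr P -> a \in P -> 'chi_i (x ^ a)%g = 'chi_i x.
Proof. by rewrite inE => /subsetP sPI /sPI; apply: inertia_valJ. Qed.

Lemma sum_cent_eqAmod (F : gT -> algC) :
    (forall x, F x \in Aint) -> {in N & P, forall x a, F (x ^ a)%g = F x} ->
  (\sum_(x in N) F x == \sum_(x in 'C_N(P)) F x %[mod p])%A.
Proof.
move=> intF invF; have nNPJ : [acts P, on N | 'J].
  by apply: subset_trans nNP _; rewrite astabsJ.
by have := sum_fix_eqAmod pP nNPJ intF invF; rewrite afixJ.
Qed.

(** Column orthogonality at elements of ['C_N(P)]: P permutes the characters without changing the
    summands, so modulo p only the invariant ones count. By [class_cent_pgroup], fusion in N is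
    fusion in ['C_N(P)], and the diagonal entries divide |N|. *)
Lemma leq_classes_invariant_irr :
  prime p -> (#|classes 'C_N(P)| <= #|invariant_irr P|)%N.
Proof.
move=> p_pr.
apply: (@leq_card_gram_mod p _ _ _ _ (fun i k => 'chi[N]_i (repr k))
   (fun k i => ('chi[N]_i (repr k)^-1%g)) (fun k => #|'C_N[repr k]|)) => //.
- by move=> i k; apply: Aint_irr.
- by move=> k i; apply: Aint_irr.
- move=> k _ /=; rewrite -p'natE //; apply: pnat_dvd p'N.
  by rewrite cardSg ?subsetIl.
move=> k k' /repr_classesP[Cx Dk] /repr_classesP[Cy Dk'] /=.
have -> : (k == k') = (repr k ^: 'C_N(P) == repr k' ^: 'C_N(P)) by rewrite -Dk -Dk'.
move: (repr k) (repr k') Cx Cy => x y Cx Cy {k k' Dk Dk'}.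
have [[Nx cPx] [Ny cPy]] := (setIP Cx, setIP Cy).
have intF i : 'chi[N]_i x^-1%g * 'chi_i y \in Aint by rewrite rpredM ?Aint_irr.
have nIP : [acts P, on [set: Iirr N] | conjg_Iirr_action].
  apply/subsetP=> a Pa; rewrite in_setI (subsetP nNP) // inE.
  by apply/subsetP=> i _; rewrite !inE.
have fixJ a z : a \in P -> z \in 'C(P) -> (z ^ a^-1)%g = z.
  by move=> Pa cPz; apply/conjg_fixP/commgP/(centP cPz); rewrite groupV.
have invF : {in [set: Iirr N] & P, forall i a,
    'chi[N]_(conjg_Iirr_action i a) x^-1%g * 'chi_(conjg_Iirr_action i a) y
     = 'chi_i x^-1%g * 'chi_i y}.
  move=> i a _ Pa /=; rewrite conjg_IirrE !cfConjgE ?(subsetP nNP) //.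
  by rewrite conjVg !fixJ.
have := sum_fix_eqAmod pP nIP intF invF.
rewrite setTI afix_conjg_Iirr // => modP; rewrite -(eqAmod_transl _ modP).
rewrite (eq_big xpredT (fun i => 'chi[N]_i y * ('chi_i x)^*%C)) => [|i|i _]; last first.
- by rewrite irr_inv mulrC.
- by rewrite inE.
rewrite second_orthogonality_relation //.
have -> : (x ^: 'C_N(P) == y ^: 'C_N(P)) = (y \in x ^: N).
  rewrite (sameP eqP class_eqP) class_sym; apply/idP/idP; last exact: class_cent_pgroup.
  by apply: subsetP; rewrite imsetS ?subsetIl.
have [/imsetP[a Na ->] | _] := boolP (y \in _); last by rewrite !mulr0n eqAmod_refl.
suffices -> : #|'C_N[(x ^ a)%g]| = #|'C_N[x]| by rewrite eqAmod_refl.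
by rewrite -(cardJg 'C_N[x] a) conjIg conjGid // cent1J.
Qed.

(** Row orthogonality for invariant characters: modulo p the sum over N reduces to ['C_N(P)], and is
    then collected by classes. *)
Lemma leq_invariant_irr_classes :
  prime p -> (#|invariant_irr P| <= #|classes 'C_N(P)|)%N.
Proof.
move=> p_pr.
apply: (@leq_card_gram_mod p _ _ _ _ (fun k i => 'chi[N]_i (repr k))
   (fun i k => #|k|%:R * ('chi[N]_i (repr k)^-1%g)) (fun=> #|N|)) => //.
- by move=> k i; apply: Aint_irr.
- by move=> i k; rewrite rpredM ?Aint_irr ?rpred_nat.
- by move=> k _; apply: prime_p'group.
move=> i j invi invj /=; pose F x := 'chi[N]_i x^-1%g * 'chi_j x.
have invF : {in N & P, forall x a, F (x ^ a)%g = F x}.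
  by move=> x a _ Pa; rewrite /F -conjVg !invariant_irrJ.
have intF x : F x \in Aint by rewrite /F rpredM ?Aint_irr.
have := sum_cent_eqAmod intF invF.
rewrite [X in (_ == X %[mod _])%A]sum_by_classes; last first.
  move=> x a Cx /setIP[Na _]; rewrite /F -conjVg !cfunJ //.
rewrite (eq_bigr _ (fun k _ => mulrA _ _ _)) => modP; rewrite -(eqAmod_transl _ modP).
rewrite (eq_bigr (fun x => 'chi_j x * 'chi_i x^-1%g)) => [|x _]; last exact: mulrC.
have /(canRL (mulVKf (neq0CG N))) -> := first_orthogonality_relation j i.
by rewrite eq_sym mulr_natr eqAmod_refl.
Qed.

End CoprimeAction.

(** The class sum of [x] acts as the scalar given by the central character; multiply by the matrix
    of [y] and take traces. *)
Lemma sum_class_irrM (gT : finGroupType) (G : {group gT}) (i : Iirr G) x y :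
    x \in G -> y \in G ->
  \sum_(z in x ^: G) 'chi_i (z * y)%g
    = #|x ^: G|%:R * 'chi_i x / 'chi_i 1%g * 'chi_i y.
Proof.
move=> Gx Gy; pose k := enum_rank_in (classes1 G) (x ^: G).
have Dk : enum_val k = x ^: G by rewrite enum_rankK_in ?mem_classes.
have sKG : {subset x ^: G <= G} by apply/subsetP/class_subG.
have kx : x \in enum_val k by rewrite Dk class_refl.
rewrite -(gring_mode_class_sum_eq i kx).
have opK : gring_op 'Chi_i (gring_class_sum _ k) = \sum_(z in x ^: G) 'Chi_i z.
  rewrite /gring_class_sum Dk /gset_mx linear_sum /=.
  by apply: eq_bigr => z /sKG Gz; rewrite gring_opG.
have trE z : z \in G -> 'chi_i z = \tr ('Chi_i z).
  by move=> Gz; rewrite -[in LHS]irrRepr cfunE Gz.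
have := irr_gring_center i (gring_class_sum_central _ k); rewrite opK.
move/(congr1 (fun A => \tr (A *m 'Chi_i y))).
rewrite mul_scalar_mx linearZ /= mulmx_suml raddf_sum /= -trE // => <-.
by apply: eq_bigr => z /sKG Gz; rewrite trE ?groupM // repr_mxM.
Qed.

(* This is the Glauberman correspondence for p-groups: the sum of x ^: N acts *)
(* as a scalar in the representation affording chi_i; multiply it by          *)
(* \sum_(y in 'C_N(P)) chi_j y^-1 * y, take traces, and discard the          *)
(* nontrivial P-orbits on x ^: N.                                             *)
Lemma irr_cent_eqAmod (gT : finGroupType) (N P : {group gT}) (p : nat)
    (i : Iirr N) (j : Iirr 'C_N(P)) x :
    prime p -> p.-group P -> p^'.-group N -> P \subset 'N(N) ->
    i \in invariant_irr N P -> ~~ (p %| '['Res['C_N(P)] 'chi_i, 'chi_j])%C ->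
    x \in 'C_N(P) ->
  ('chi_j 1%g * 'chi_i x == 'chi_i 1%g * 'chi_j x %[mod p])%A.
Proof.
move=> p_pr pP p'N nNP invi p'ij Cx.
have sCN : 'C_N(P) \subset N := subsetIl _ _.
have [Nx cPx] := setIP Cx.
pose F z := \sum_(y in 'C_N(P)) 'chi_j y^-1%g * 'chi_i (z * y)%g.
have [m Em] : {m | '['Res['C_N(P)] 'chi_i, 'chi_j] = m}.
  by exists '['Res['C_N(P)] 'chi_i, 'chi_j].
have intF z : F z \in Aint by rewrite rpred_sum // => y _; rewrite rpredM ?Aint_irr.
have nKP : [acts P, on x ^: N | 'J].
  rewrite astabsJ -class_support_set1l norms_class_support //.
  by rewrite (subset_trans _ (cent_sub _)) // centsC sub1set.
have invF : {in x ^: N & P, forall z a, F ('J%act z a) = F z}.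
  move=> z a _ Pa; apply: eq_bigr => y /setIP[_ cPy]; congr (_ * _) => /=.
  have Dy : (y ^ a)%g = y by apply/conjg_fixP/commgP/(centP cPy).
  by rewrite -{1}Dy -conjMg (invariant_irrJ _ invi).
have := sum_fix_eqAmod pP nKP intF invF; rewrite afixJ.
have defK : (x ^: N :&: 'C(P))%g = x ^: 'C_N(P).
  apply/eqP; rewrite eqEsubset subsetI imsetS //=.
  rewrite (subset_trans (class_subG Cx (subxx _))) ?subsetIr // andbT.
  apply/subsetP=> z /setIP[xNz cPz]; apply: (class_cent_pgroup pP _ _ p_pr Cx _ xNz) => //.
  by rewrite inE cPz andbT (subsetP (class_subG Nx (subxx N)) z).
rewrite defK; have -> : \sum_(z in x ^: N) F z
          = #|x ^: N|%:R * 'chi_i x / 'chi_i 1%g * (#|'C_N(P)|%:R * m).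
  rewrite exchange_big /= -Em cfdotE mulVKf ?neq0CG // mulr_sumr.
  apply: eq_bigr => y Cy; have Ny := subsetP sCN y Cy.
  by rewrite -mulr_sumr sum_class_irrM // irr_inv mulrCA cfResE // [_^* * _]mulrC.
have -> : \sum_(z in x ^: 'C_N(P)) F z
          = #|x ^: 'C_N(P)|%:R * 'chi_j x / 'chi_j 1%g * (#|'C_N(P)|%:R * m).
  have -> : #|x ^: 'C_N(P)|%:R * 'chi_j x / 'chi_j 1%g * (#|'C_N(P)|%:R * m)
        = \sum_(z in x ^: 'C_N(P)) m * (#|'C_N(P)|%:R * ('chi_j x / 'chi_j 1%g)).
    rewrite sumr_const -[RHS]mulr_natl -!mulrA; congr (_ * _).
    by rewrite [LHS]mulrA [RHS]mulrA [RHS]mulrC [m * _]mulrC.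
  apply: eq_bigr => _ /imsetP[u Cu ->]; rewrite -['chi_j x](cfunJ _ _ Cu).
  have: (x ^ u)%g \in 'C_N(P) by rewrite groupJ.
  move: (x ^ u)%g => z Cz.
  (* Expanding the restriction of chi_i into irreducibles, generalised orthogonality keeps only the
     term [l = j], of multiplicity [m]. *)
  transitivity (\sum_(y in 'C_N(P)) \sum_l '['Res['C_N(P)] 'chi_i, 'chi_l]
       * ('chi_l (y * z)%g * 'chi_j y^-1%g)).
    apply: eq_bigr => y Cy; have Nzy : (z * y)%g \in 'C_N(P) by rewrite groupM.
    rewrite -(cfResE _ sCN Nzy) {1}['Res _]cfun_sum_cfdot sum_cfunE mulr_sumr.
    apply: eq_bigr => l _; rewrite cfunE mulrC -mulrA.
    by rewrite -(cfunJ 'chi_l (z * y)%g Cz) conjgE mulgA mulKg.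
  rewrite exchange_big /=; under eq_bigr do rewrite -mulr_sumr.
  have orth l : \sum_(y in 'C_N(P)) 'chi_l (y * z)%g * 'chi_j y^-1%g
      = #|'C_N(P)|%:R * ((l == j)%:R * ('chi_l z / 'chi_l 1%g)).
    exact: canRL (mulVKf (neq0CG _)) (generalized_orthogonality_relation z l j).
  rewrite (bigD1 j) //= orth big1 => [|l /negPf nlj].
    by rewrite addr0 Em eqxx mul1r.
  by rewrite orth nlj mul0r !mulr0.
have /natrP[n Dm] : m \in Num.nat by rewrite -Em Cnat_cfdot_char ?cfRes_char ?irr_char.
have p'n : ~~ (p %| n)%N by move: p'ij; rewrite Em Dm dvdC_nat.
have p'C : ~~ (p %| #|'C_N(P)|)%N.
  by apply: prime_p'group => //; apply: pgroupS p'N.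
have co_p k : ~~ (p %| k)%N -> coprime k p by rewrite coprime_sym prime_coprime.
set a := _ / _; set b := (X in (_ == X * _ %[mod _])%A -> _).
have Aa : a \in Aint by apply: Aint_class_div_irr1.
have Ab : b \in Aint by apply: Aint_class_div_irr1.
rewrite Dm -natrM /eqAmod -mulrBl mulrC => p_ab.
have {}p_ab : (p %| a - b)%A.
  apply: dvdA_pmul2l p_ab; rewrite ?rpredB // ?co_p ?Euclid_dvdM ?negb_or ?p'C //.
  by rewrite muln_gt0 cardG_gt0 lt0n; apply: contraNneq p'n => ->.
have oK : (p %| #|x ^: N|%:R - #|x ^: 'C_N(P)|%:R)%A.
  have := pgroup_fix_mod pP nKP; rewrite afixJ defK => /eqP.
  by rewrite -eqAmod_nat.
have p'K : ~~ (p %| #|x ^: 'C_N(P)|)%N.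
  by apply: contra p'C => /dvdn_trans-> //; rewrite -index_cent1 dvdn_indexg.
apply: (@dvdA_pmul2l p #|x ^: 'C_N(P)|); rewrite ?co_p // ?rpredB ?rpredM ?Aint_irr //.
  by apply/card_gt0P; exists x; apply: class_refl.
(* The class sizes in N and in ['C_N(P)] agree modulo p, so the congruence of central characters [a]
   and [b] passes to character values after multiplying by a class size prime to p. *)
have nz_i := irr1_neq0 i; have nz_j := irr1_neq0 j.
have -> : #|x ^: 'C_N(P)|%:R * ('chi_j 1%g * 'chi_i x - 'chi_i 1%g * 'chi_j x)
  = 'chi_i 1%g * 'chi_j 1%g * (a - b) -
    'chi_j 1%g * 'chi_i x * (#|x ^: N|%:R - #|x ^: 'C_N(P)|%:R).
  by rewrite /a /b; field; rewrite nz_i nz_j.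
by rewrite rpredB // dvdA_mull ?rpredM ?Aint_irr.
Qed.

Lemma irr1_p'group (gT : finGroupType) (G : {group gT}) (p : nat) (i : Iirr G) :
  prime p -> p^'.-group G -> exists2 n : nat, 'chi_i 1%g = n%:R & ~~ (p %| n)%N.
Proof.
move=> p_pr p'G; have /natrP[n Dn] := Cnat_irr1 i; exists n => //.
have := dvd_irr1_cardG i; rewrite Dn dvdC_nat => n_dv_G.
by rewrite -p'natE // (pnat_dvd n_dv_G).
Qed.

(** If i and j differed, the scalar product of a chi_i - b chi_j with chi_i would give a |N|, prime
    to p; but modulo p the sum reduces to ['C_N(P)], where each term vanishes. *)
Lemma invariant_irr_modP (gT : finGroupType) (N P : {group gT}) (p a b : nat) i j :
    prime p -> p.-group P -> p^'.-group N -> P \subset 'N(N) ->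
    i \in invariant_irr N P -> j \in invariant_irr N P -> ~~ (p %| a)%N ->
    {in 'C_N(P), forall x, (a%:R * 'chi_i x == b%:R * 'chi_j x %[mod p])%A} ->
  i = j.
Proof.
move=> p_pr pP p'N nNP invi invj p'a eq_ij; apply: contraNeq p'a => neq_ij.
pose F x := (a%:R * 'chi_i x - b%:R * 'chi_j x) * 'chi_i x^-1%g.
have intF x : F x \in Aint by rewrite rpredM ?rpredB ?rpredM ?Aint_irr ?rpred_nat.
have invF : {in N & P, forall x u, F (x ^ u)%g = F x}.
  by move=> x u _ Pu; rewrite /F -conjVg !(invariant_irrJ _ invi) ?(invariant_irrJ _ invj).
have := sum_cent_eqAmod pP nNP intF invF.
have -> : \sum_(x in N) F x = #|N|%:R * a%:R.
  have orth l := canRL (mulVKf (neq0CG _)) (first_orthogonality_relation l i).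
  rewrite /F; under eq_bigr do rewrite mulrBl -!mulrA.
  rewrite sumrB -!mulr_sumr !orth eqxx [j == i]eq_sym (negPf neq_ij).
  by rewrite !mulr0 subr0 mulr1 mulrC.
move=> eqF; have p_dv : (p %| \sum_(x in 'C_N(P)) F x)%A.
  by apply: dvdA_sum => x Cx; rewrite /F mulrC dvdA_mull ?Aint_irr //; apply: eq_ij.
have: (p %| (#|N| * a)%:R)%A by rewrite natrM -eqAmod0 (eqAmod_transl _ eqF) eqAmod0.
rewrite -eqAmod0 eqAmod0_nat Euclid_dvdM // => /orP[] // pN.
by rewrite (negPf (prime_p'group p'N p_pr)) in pN.
Qed.

(** The Glauberman map [h] sends a Q-invariant character of N to the constituent of its restriction
    to ['C_N(Q)] whose multiplicity is prime to q. By [irr_cent_eqAmod] and [invariant_irr_modP]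
    that constituent is unique and [h] is injective; uniqueness also makes [h] preserve
    P-invariance. *)
Lemma leq_invariant_irr_cent (gT : finGroupType) (N P Q : {group gT}) (q : nat) :
    prime q -> q.-group Q -> q^'.-group N -> Q \subset 'N(N) ->
    P \subset 'N(N) -> P \subset 'N(Q) ->
  (#|invariant_irr N P :&: invariant_irr N Q|
     <= #|invariant_irr 'C_N(Q) P|)%N.
Proof.
move=> q_pr qQ q'N nNQ nNP nQP; set C := 'C_N(Q)%G.
have sCN : C \subset N := subsetIl _ _.
have q'C : q^'.-group C := pgroupS sCN q'N.
pose good i j := ~~ (q %| '['Res[C] 'chi[N]_i, 'chi[C]_j])%C.
pose h i := odflt 0 [pick j | good i j].
(* The default 0 never matters here: were all multiplicities divisible by q, so would be the degree
   of chi_i. *)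
have hP i : i \in invariant_irr N Q -> good i (h i).
  rewrite /h; case: pickP => //= nogood inv_i.
  have [n Dn /negP[]] := irr1_p'group i q_pr q'N.
  suffices: (q %| 'chi_i 1%g)%C by rewrite Dn dvdC_nat.
  rewrite -(cfResE _ sCN (group1 _)) ['Res _]cfun_sum_cfdot sum_cfunE.
  apply: rpred_sum => l _; rewrite cfunE dvdC_mulr ?(intr_nat (Cnat_irr1 _)) //.
  exact: (negbFE (nogood l)).
have eq_good i j : i \in invariant_irr N Q -> good i j ->
   {in C, forall x, ('chi_j 1%g * 'chi_i x == 'chi_i 1%g * 'chi_j x %[mod q])%A}.
  by move=> inv_i good_ij x Cx; apply: irr_cent_eqAmod qQ q'N nNQ inv_i good_ij Cx.
have good_uniq i j j' : i \in invariant_irr N Q -> good i j -> good i j' -> j = j'.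
  move=> inv_i gj gj'.
  have [[n Dn q'n] [m Dm q'm] [m' Dm' q'm']] :=
    And3 (irr1_p'group i q_pr q'N) (irr1_p'group j q_pr q'C) (irr1_p'group j' q_pr q'C).
  (* With the trivial group acting, the centraliser is all of C, where both constituents are
     compared with chi_i; the factors clear the degrees. *)
  apply: (@invariant_irr_modP _ C 1%G q (n * m')%N (n * m)%N) => //.
  - exact: pgroup1.
  - exact: sub1G.
  - by rewrite inE sub1G.
  - by rewrite inE sub1G.
  - by rewrite Euclid_dvdM // negb_or q'n.
  move=> x /setIP[Cx _]; rewrite !natrM -Dn -Dm -Dm'.
  rewrite -!mulrA !['chi_i 1%g * _]mulrCA.
  have eq_j := eqAmodMl (Aint_irr j' 1%g) (eq_good i j inv_i gj x Cx).
  have eq_j' := eqAmodMl (Aint_irr j 1%g) (eq_good i j' inv_i gj' x Cx).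
  by rewrite -(eqAmod_transl _ eq_j) -(eqAmod_transr _ eq_j') mulrCA eqAmod_refl.
have inj_h : {in invariant_irr N P :&: invariant_irr N Q &, injective h}.
  move=> i i' /setIP[_ inv_i] /setIP[_ inv_i'] eq_h.
  have [[n Dn q'n] [n' Dn' q'n']] := (irr1_p'group i q_pr q'N, irr1_p'group i' q_pr q'N).
  have [m Dm q'm] := irr1_p'group (h i) q_pr q'C.
  apply: (@invariant_irr_modP _ N Q q (n' * m)%N (n * m)%N) => //.
    by rewrite Euclid_dvdM // negb_or q'n'.
  move=> x Cx; rewrite !natrM -Dn -Dn' -Dm -!mulrA.
  have eq_i := eqAmodMl (Aint_irr i' 1%g) (eq_good i _ inv_i (hP i inv_i) x Cx).
  have := eqAmodMl (Aint_irr i 1%g) (eq_good i' _ inv_i' (hP i' inv_i') x Cx).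
  rewrite -eq_h mulrCA => eq_i'.
  by rewrite (eqAmod_transl _ eq_i) (eqAmod_transr _ eq_i') mulrCA.
rewrite -(card_in_imset inj_h) subset_leq_card //.
apply/subsetP=> _ /imsetP[i /setIP[inv_i inv_iQ] ->].
rewrite inE; apply/subsetP=> a Pa.
have nNa := subsetP nNP a Pa.
have nCa : a \in 'N(C) by apply: subsetP Pa; rewrite normsI ?norms_cent.
rewrite inE nCa -conjg_IirrE; apply/eqP; congr 'chi__; apply: good_uniq (hP i _) => //.
rewrite /good conjg_IirrE -{1}(inertiaJ (subsetP _ a Pa : a \in 'I['chi_i])) //.
  by rewrite -cfConjgRes_norm // cfConjg_iso; apply: hP.
by move: inv_i; rewrite inE.
Qed.

(* The numbers of classes of 'C_N(P) and 'C_N(P * Q) are those of the         *)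
(* P-invariant and P * Q-invariant irreducible characters of N; when these    *)
(* agree every class of 'C_N(P) meets 'C_N(P * Q), so the two groups coincide.*)
Lemma cent_sub_invariant_irr (gT : finGroupType) (N P Q : {group gT}) (p q : nat) :
    prime p -> prime q -> p.-group P -> q.-group Q ->
    p^'.-group N -> q^'.-group N -> P \subset 'N(N) -> Q \subset 'N(N) ->
    P \subset 'N(Q) -> invariant_irr N P \subset invariant_irr N Q ->
  'C_N(P) \subset 'C(Q).
Proof.
move=> p_pr q_pr pP qQ p'N q'N nNP nNQ nQP sPQ.
set C := 'C_N(Q)%G; have sCN : C \subset N := subsetIl _ _.
have nCP : P \subset 'N(C) by rewrite normsI ?norms_cent.
have p'C : p^'.-group C := pgroupS sCN p'N.
pose A := 'C_C(P)%G; pose B := 'C_N(P)%G.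
have sAB : A \subset B by rewrite setSI.
have leBA : (#|classes B| <= #|classes A|)%N.
  apply: leq_trans (leq_classes_invariant_irr pP p'N nNP p_pr) _.
  apply: leq_trans (leq_invariant_irr_classes pP p'C nCP p_pr).
  by rewrite -{1}(setIidPl sPQ) (leq_invariant_irr_cent q_pr).
pose f (k : {set gT}) := repr k ^: B.
have inj_f : {in classes A &, injective f}.
  move=> k k' /repr_classesP[Ak Dk] /repr_classesP[Ak' Dk'] eq_f.
  have [[Ck _] [Ck' _]] := (setIP Ak, setIP Ak').
  rewrite Dk Dk'; apply/class_eqP; apply: (class_cent_pgroup (N := C) pP) => //.
  (* Conjugacy in B gives conjugacy in N, which descends to ['C_N(Q)] and from there to A. *)
  apply: (class_cent_pgroup qQ q'N nNQ q_pr) => //.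
  have: repr k \in repr k' ^: B by apply/class_eqP.
  by apply: subsetP; rewrite imsetS ?subsetIl.
have fA : f @: classes A = classes B.
  apply/eqP; rewrite eqEcard (card_in_imset inj_f) leBA andbT.
  apply/subsetP=> _ /imsetP[k /repr_classesP[Ak _] ->].
  by rewrite mem_classes ?(subsetP sAB).
suffices -> : B :=: A by rewrite /A /= setIC setIA subsetIr.
apply: class_support_eqG => //; apply/subsetP=> b Bb.
have: b ^: B \in f @: classes A by rewrite fA mem_classes.
case/imsetP=> k /repr_classesP[Ak _] /class_eqP/imsetP[c Bc ->].
exact: memJ_class_support.
Qed.

(** * Groups whose chief factors are p-groups or p'-groups *)

Local Open Scope group_scope.

(** A series-free form of p-solvability: any normal section can be refined from below. It passes to
    quotients and applies directly to a chosen section such as the one in Hall-Higman. *)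
Definition p_separable (p : nat) (gT : finGroupType) (G : {group gT}) : Prop :=
  forall V U : {group gT}, V <| G -> U <| G -> V \proper U ->
  exists W : {group gT}, [/\ W <| G, V \proper W, W \subset U
    & p.-nat #|W : V| || p^'.-nat #|W : V|].

(** At the first factor B / A of the series with B :&: U not inside V, the subgroup V (B :&: U)
    works: its index over V divides |B :&: U : A|. *)
Lemma p_solvable_separable (p : nat) (gT : finGroupType) (G : {group gT}) :
  p_solvable G p -> p_separable p G.
Proof.
case=> s s_path s_last V U nsVG nsUG ltVU.
have [[sVG nVG] [sUG nUG]] := (andP nsVG, andP nsUG).
have [sVU not_sUV] := andP ltVU.
have sAUV : 1%G :&: U \subset V by rewrite subIset ?sub1G.
elim: s 1%G sAUV s_path s_last => /= [A sGUV _ defG | B s IHs A sAUV].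
  by case/negP: not_sUV; rewrite (subset_trans _ sGUV) // defG subsetI sUG subxx.
case/andP=> /andP[/and3P[nAG nBG /andP[sAB nAB]] pi_BA].
have [sBUV | not_sBUV] := boolP (B :&: U \subset V); first exact: IHs.
move=> Bs Bs_last.
have sBG : B \subset G.
  rewrite -{}Bs_last; elim: s B Bs {IHs pi_BA sAB nAB nBG not_sBUV} => //= C s IHs B.
  case/andP=> /andP[/and3P[_ _ /andP[sBC _]] _] /IHs.
  exact: subset_trans.
have nsBUG : B :&: U <| G by rewrite /normal subIset ?sBG // normsI.
have nVBU : B :&: U \subset 'N(V) := subset_trans (normal_sub nsBUG) nVG.
exists (V <*> (B :&: U))%G; split.
- by rewrite normalY.
- by rewrite properE joing_subl join_subG subxx.
- by rewrite join_subG sVU subsetIr.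
suffices pi_ind (pi : nat_pred) : pi.-group (B / A) -> pi.-nat #|V <*> (B :&: U) : V|.
  by case/orP: pi_BA => /pi_ind->; rewrite ?orbT.
move=> pi_B; rewrite -card_quotient ?join_subG ?normG // quotientYidl // card_quotient //.
apply: (@pnat_dvd _ #|B :&: U : A|).
  rewrite -[X in (_ %| X)%N]indexgI; apply: indexgS.
  by rewrite /= setIAC (setIidPr sAB).
rewrite -card_quotient; last exact: subset_trans (subsetIl _ _) nAB.
by apply: pgroupS pi_B; rewrite quotientS ?subsetIl.
Qed.

Lemma quotient_separable (p : nat) (gT : finGroupType) (G N : {group gT}) :
  N <| G -> p_separable p G -> p_separable p (G / N).
Proof.
move=> nsNG sepG Vb Ub nsV nsU ltVU.
have [sNG nNG] := andP nsNG.
pose pre (H : {group coset_of N}) := (coset N @*^-1 H)%G.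
have pre_ns (H : {group coset_of N}) : H <| G / N -> pre H <| G.
  by move=> nsH; rewrite -(quotientGK nsNG) morphpre_normal ?sub_im_coset //.
have [|W [nsW ltVW sWU piW]] := sepG (pre Vb) (pre Ub) (pre_ns _ nsV) (pre_ns _ nsU).
  by rewrite morphpre_proper ?sub_im_coset.
exists (W / N)%G.
have sNW : N \subset W by rewrite (subset_trans _ (proper_sub ltVW)) // sub_cosetpre.
have nsNW : N <| W by rewrite (normalS _ (normal_sub nsW)).
split.
- by rewrite quotient_normal.
- by rewrite -(cosetpreK Vb) quotient_proper // normal_cosetpre.
- by rewrite -(cosetpreK Ub) quotientS.
have <- : #|W : pre Vb| = #|W / N : Vb|.
  by rewrite -(index_morphpre _ (sub_im_coset _)) /= quotientGK.
by [].
Qed.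

Lemma minnormal_separable (p : nat) (gT : finGroupType) (G N : {group gT}) :
  p_separable p G -> minnormal N G -> N \subset G -> p.-group N || p^'.-group N.
Proof.
move=> sepG minN sNG; have [/andP[ntN nNG] minN'] := mingroupP minN.
have [||| W [nsWG lt1W sWN]] := sepG 1%G N; first exact: normal1.
- exact/andP.
- by rewrite proper1G.
rewrite indexg1 (minN' W) // -proper1G lt1W; exact: normal_norm nsWG.
Qed.

(** The Hall-Higman lemma. Otherwise some normal W lies above Z inside C: if W / Z is a p-group, W
    falls into O_p(G); if it is a p'-group, a complement of the central Z in W is a normal
    p'-subgroup of W, hence trivial. *)
Lemma separable_cent_pcore (p : nat) (gT : finGroupType) (G : {group gT}) :
  p_separable p G -> 'O_p^'(G) = 1 -> 'C_G('O_p(G)) \subset 'O_p(G).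
Proof.
move=> sepG Op'1; set V := 'O_p(G)%G; set C := 'C_G(V)%G.
have nsVG : V <| G by apply: pcore_normal.
have nsCG : C <| G by rewrite /normal subsetIl normsI ?normG ?norms_cent ?normal_norm.
apply: contraT => not_sCV; pose Z := (V :&: C)%G.
have nsZG : Z <| G by rewrite normalI.
have [|W [nsWG ltZW sWC piW]] := sepG Z C nsZG nsCG.
  by rewrite properE subsetIr subsetI subxx andbT.
have sZW := proper_sub ltZW.
have pZ : p.-group Z := pgroupS (subsetIl _ _) (pcore_pgroup p G).
have oW : #|W| = (#|Z| * #|W : Z|)%N by rewrite Lagrange.
case/orP: piW => [pW | p'W].
  have: W \subset Z.
    by rewrite subsetI sWC pcore_max // /pgroup oW pnatM pW andbT.
  by move=> sWZ; rewrite properE sWZ andbF in ltZW.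
have nsZW : Z <| W by rewrite (normalS sZW (normal_sub nsWG)).
have hallZ : Hall W Z by rewrite /Hall sZW (pnat_coprime pZ).
have /splitsP[K /complP[tiZK defW]] := SchurZassenhaus_split hallZ nsZW.
have cZK : K \subset 'C(Z).
  rewrite centsC (subset_trans (subsetIl _ _)) // centsC.
  apply: subset_trans (subsetIr G _); apply: subset_trans sWC.
  by rewrite -defW mulG_subr.
have nsKW : K <| W.
  by rewrite -defW /normal mulG_subr mulG_subG normG andbT cents_norm // centsC.
have p'K : p^'.-group K.
  have /eqP := TI_cardMg tiZK; rewrite defW oW eqn_pmul2l // /pgroup.
  by move/eqP <-.
have sKO : K \subset 'O_p^'(G).
  apply: subset_trans (pcore_max p'K nsKW) _.
  by apply: pcore_max (pcore_pgroup _ _) (char_normal_trans (pcore_char _ _) nsWG).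
have K1 : K :=: 1 by apply/trivgP; rewrite -Op'1.
by move: ltZW; rewrite -defW K1 mulg1 properxx.
Qed.

Lemma normal_sub_pi'index (pi : nat_pred) (gT : finGroupType) (G N T : {group gT}) :
  N <| G -> T \subset G -> pi.-group N -> pi^'.-nat #|G : T| -> N \subset T.
Proof.
move=> nsNG sTG piN pi'T; rewrite -indexg_eq1.
have [_ nNG] := andP nsNG; have nNT := subset_trans sTG nNG.
have piNT : pi.-nat #|N : T| := pnat_dvd (dvdn_indexg N T) piN.
rewrite (pnat_1 piNT) // (pnat_dvd _ pi'T) // -(indexMg T N) -norm_joinEl //.
by apply: indexSg; rewrite ?joing_subl // join_subG sTG normal_sub.
Qed.

(** QP is a Hall {p, q}-subgroup. By induction a conjugate J^g lies in N T for a minimal normal N.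
    If N is not inside T, it is a {p, q}'-group; T :&: N J^g then contains a complement of N in N
    J^g, conjugate to J^g by Schur-Zassenhaus. *)
Lemma Hall_pair_sub_conj (p q : nat) (gT : finGroupType) (G P Q T : {group gT}) :
    p_separable p G -> p_separable q G -> p.-Sylow(G) P -> q.-Sylow(G) Q ->
    P \subset 'N(Q) -> T \subset G -> p^'.-nat #|G : T| -> q^'.-nat #|G : T| ->
  exists2 g, g \in G & (Q <*> P) :^ g \subset T.
Proof.
have [n] := ubnP #|G|; elim: n => // n IHn in gT G P Q T *.
rewrite ltnS => leGn sepP sepQ sylP sylQ nQP sTG p'T q'T.
have [[sPG pP _] [sQG qQ _]] := (and3P sylP, and3P sylQ).
have [G1 | ntG] := eqVneq G 1%G.
  exists 1; rewrite // conjsg1 join_subG; rewrite G1 in sPG sQG.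
  by rewrite (subset_trans sQG) ?sub1G // (subset_trans sPG) ?sub1G.
have [N minN sNG] := minnormal_exists ntG (normG G).
have [ntN nNG] := andP (mingroupp minN).
have nsNG : N <| G by apply/andP.
have [|||||||||g'] := IHn _ (G / N)%G (P / N)%G (Q / N)%G (T / N)%G.
- by apply: leq_trans leGn; rewrite ltn_quotient.
- exact: quotient_separable.
- exact: quotient_separable.
- by rewrite quotient_pHall // (subset_trans sPG).
- by rewrite quotient_pHall // (subset_trans sQG).
- by rewrite quotient_norms.
- by rewrite quotientS.
- by rewrite (pnat_dvd _ p'T) // index_quotient // subIset // nNG.
- by rewrite (pnat_dvd _ q'T) // index_quotient // subIset // nNG.
case/morphimP=> g nNg Gg ->{g'} sJT.
pose J := (Q <*> P)%G.
have sJG : J \subset G by rewrite join_subG sQG.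
have solJ : solvable J.
  have nsQJ : Q <| J by rewrite /normal joing_subl join_subG normG.
  rewrite (series_sol nsQJ) (pgroup_sol qQ) /=  quotientYidl //.
  by rewrite quotient_sol ?(pgroup_sol pP).
have nNJ : J \subset 'N(N) := subset_trans sJG nNG.
have sJgG : J :^ g \subset G by rewrite conj_subG.
have sJgNT : J :^ g \subset N * T.
  rewrite -quotientSK ?(subset_trans sJgG) // quotientJ //.
  by rewrite quotientY // (subset_trans _ nNG).
have [sNT | not_sNT] := boolP (N \subset T).
  by exists g => //; rewrite (subset_trans sJgNT) // mul_subG.
have p'N : p^'.-group N.
  have /orP[pN | //] := minnormal_separable sepP minN sNG.
  by rewrite (normal_sub_pi'index nsNG sTG pN p'T) in not_sNT.
have q'N : q^'.-group N.
  have /orP[qN | //] := minnormal_separable sepQ minN sNG.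
  by rewrite (normal_sub_pi'index nsNG sTG qN q'T) in not_sNT.
have coNJ : coprime #|N| #|J|.
  have oJ : (#|J| %| #|Q| * #|P|)%N.
    by rewrite /J /= norm_joinEr // mul_cardG dvdn_mulr.
  rewrite (coprime_dvdr oJ) // coprimeMr coprime_sym (pnat_coprime qQ) //.
  by rewrite coprime_sym (pnat_coprime pP).
pose Jg := (J :^ g)%G; have coNJg : coprime #|N| #|Jg| by rewrite cardJg.
have nNJg : Jg \subset 'N(N) := subset_trans sJgG nNG.
pose H := (N <*> Jg)%G; have defH : H = N * Jg :> {set gT} by apply: norm_joinEr.
pose D := (T :&: H)%G.
have nND : D \subset 'N(N) by rewrite subIset // (subset_trans sTG).
have oDN : #|D : N| = #|Jg|.
  rewrite -(indexMg N D) /= (group_modl T (joing_subl N Jg)).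
  have -> : (N * T) :&: H = H.
    by apply/setIidPr; rewrite /= defH -{2}(mulGid N) -mulgA mulgS.
  by rewrite defH indexMg -indexgI setIC coprime_TIg // indexg1.
have nsND : N :&: D <| D by rewrite /normal subsetIr normsI ?normG.
have hallND : Hall D (N :&: D).
  rewrite /Hall subsetIr setIC indexgI oDN (coprime_dvdl _ coNJg) // cardSg ?subsetIr //.
have /splitsP[K /complP[tiNK defD]] := SchurZassenhaus_split hallND nsND.
have oK : #|K| = #|Jg|.
  apply/eqP; rewrite -(eqn_pmul2l (cardG_gt0 (N :&: D))) -(TI_cardMg tiNK) defD.
  by rewrite -oDN -(indexgI D N) (setIC D N) Lagrange ?subsetIr.
have sKD : K \subset D by rewrite -defD mulG_subr.
have [|||||x Nx defK] := @SchurZassenhaus_trans_actsol _ N Jg K.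
- by rewrite -(isog_sol (conj_isog J g)).
- exact: nNJg.
- by rewrite joingC (subset_trans sKD) ?subsetIr.
- exact: coNJg.
- by [].
exists (g * x); first by rewrite groupM // (subsetP sNG).
by rewrite conjsgM -[_ :^ x]defK (subset_trans sKD) ?subsetIl.
Qed.

(** Some conjugate of QP by g lies in T; Sylow's theorem in T corrects g by t so that g t normalises
    P, hence Q. *)
Lemma Sylow_sub_index (p q : nat) (gT : finGroupType) (G P Q T : {group gT}) :
    p_separable p G -> p_separable q G -> p.-Sylow(G) P -> q.-Sylow(G) Q ->
    'N_G(P) \subset 'N(Q) -> P \subset T -> T \subset G -> q^'.-nat #|G : T| ->
  Q \subset T.
Proof.
move=> sepP sepQ sylP sylQ nPQ sPT sTG q'T.
have [sPG pP p'P] := and3P sylP.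
have nQP : P \subset 'N(Q) by rewrite (subset_trans _ nPQ) // subsetI sPG normG.
have p'T : p^'.-nat #|G : T| by apply: pnat_dvd p'P; rewrite indexgS.
have [g Gg] := Hall_pair_sub_conj sepP sepQ sylP sylQ nQP sTG p'T q'T.
rewrite conjYg join_subG => /andP[sQT sPgT].
have sylPT : p.-Sylow(T) P := pHall_subl sPT sTG sylP.
have sylPg : p.-Sylow(T) (P :^ g) by rewrite (pHall_subl sPgT sTG) // pHallJ.
have [t Tt defP] := Sylow_trans sylPg sylPT.
have /(subsetP nPQ)/normP <- : (g * t)%g \in 'N_G(P).
  by rewrite inE groupM // ?(subsetP sTG) //; apply/normP; rewrite conjsgM -defP.
by rewrite conjsgM -(conjGid Tt) conjSg.
Qed.

(** * Characters of p'-degree *)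

Local Open Scope ring_scope.

(** The induced character has degree prime to p, so some constituent does too; Frobenius reciprocity
    puts it above chi_j. *)
Lemma exists_p'irr_over (p : nat) (gT : finGroupType) (G S : {group gT}) (j : Iirr S) :
    prime p -> S \subset G -> ~~ (p %| #|G : S|)%N -> ~~ (p %| 'chi_j 1%g)%C ->
  exists2 i : Iirr G, j \in irr_constt ('Res[S] 'chi_i) & ~~ (p %| 'chi_i 1%g)%C.
Proof.
move=> p_pr sSG p'GS p'j.
pose good i := (j \in irr_constt ('Res[S] 'chi[G]_i)) && ~~ (p %| 'chi_i 1%g)%C.
have [i /andP[] | all_p] := pickP good; first by exists i.
have: (p %| ('Ind[G] 'chi_j) 1%g)%C.
  rewrite ['Ind _]cfun_sum_constt sum_cfunE; apply: rpred_sum => i.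
  rewrite constt_Ind_Res => chi_j; have := all_p i.
  rewrite /good chi_j => /negbFE p_i; rewrite cfunE dvdC_mull //.
  by rewrite intr_nat // Cnat_cfdot_char_irr // cfInd_char ?irr_char.
have /natrP[n Dn] := Cnat_irr1 j; move: p'j.
by rewrite cfInd1 // Dn -natrM !dvdC_nat Euclid_dvdM // (negPf p'GS) => /negPf->.
Qed.

Lemma index_inertia_dvd_irr1 (gT : finGroupType) (G H : {group gT}) i (j : Iirr H) :
    H <| G -> j \in irr_constt ('Res[H] 'chi[G]_i) ->
  (#|G : 'I_G['chi_j]| %| 'chi_i 1%g)%C.
Proof.
move=> nsHG chi_j; have sHG := normal_sub nsHG.
rewrite -(cfResE _ sHG (group1 H)) (Clifford_Res_sum_cfclass nsHG chi_j) cfunE.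
rewrite sum_cfunE (eq_big_seq (fun=> 'chi_j 1%g)) => [|_ /cfclassP[y _ ->]]; last first.
  by rewrite cfConjg1.
rewrite big_const_seq count_predT size_cfclass iter_addr addr0 -mulr_natr mulrA.
rewrite dvdC_mull // rpredM ?intr_nat ?Cnat_irr1 //.
by rewrite Cnat_cfdot_char_irr // cfRes_char ?irr_char.
Qed.

Definition p'irr_are_q' (p q : nat) (gT : finGroupType) (G : {group gT}) : Prop :=
  forall i : Iirr G, ~~ (p %| 'chi_i 1%g)%C -> ~~ (q %| 'chi_i 1%g)%C.

Lemma p'irr_are_q'_quotient (p q : nat) (gT : finGroupType) (G N : {group gT}) :
  N <| G -> p'irr_are_q' p q G -> p'irr_are_q' p q (G / N)%G.
Proof.
move=> nsNG degG i; have := degG (mod_Iirr i).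
by rewrite mod_IirrE // cfMod1.
Qed.

Lemma Sylow_lift (p : nat) (gT : finGroupType) (G N : {group gT})
    (Pb : {group coset_of N}) :
    N <| G -> p.-Sylow(G / N) Pb ->
  exists2 P : {group gT}, p.-Sylow(G) P & (P / N)%g = Pb.
Proof.
move=> nsNG sylPb; have [P sylP] := Sylow_exists p G.
have nNG := normal_norm nsNG.
have sylPN : p.-Sylow(G / N) (P / N)%g.
  by rewrite quotient_pHall // (subset_trans (pHall_sub sylP)).
have [_ /morphimP[x nNx Gx ->] ->] := Sylow_trans sylPN sylPb.
by exists (P :^ x)%G; [rewrite pHallJ | rewrite /= quotientJ].
Qed.

Local Open Scope group_scope.

(** * The Navarro-Wolf theorem: induction along a minimal normal subgroup *)

Section InductionStep.

Variables (p q : nat) (gT : finGroupType) (G N P Q : {group gT}).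
Hypotheses (p_pr : prime p) (q_pr : prime q).
Hypotheses (sepP : p_separable p G) (sepQ : p_separable q G).
Hypotheses (degG : p'irr_are_q' p q G) (nsNG : N <| G).
Hypotheses (sylP : p.-Sylow(G) P) (sylQ : q.-Sylow(G) Q).
Hypothesis nPQb : 'N_(G / N)(P / N) \subset 'N(Q / N).

Lemma norm_Sylow_quotient : 'N_G(P) \subset 'N(N <*> Q).
Proof.
have nNG := normal_norm nsNG; have sQG := pHall_sub sylQ.
have nNQ : Q \subset 'N(N) := subset_trans sQG nNG.
have nsNQ : N <| N <*> Q by rewrite /normal joing_subl join_subG normG.
have nNNP : 'N_G(P) \subset 'N(N) by rewrite subIset ?nNG.
have: 'N_G(P) / N \subset 'N(N <*> Q) / N.
  rewrite (quotient_normG nsNQ) quotientYidl //.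
  apply: subset_trans nPQb; rewrite subsetI quotientS ?subsetIl //.
  by rewrite quotient_norms // subsetIr.
rewrite quotientSK // => /subset_trans-> //.
by rewrite mulG_subG subxx andbT (subset_trans (joing_subl N Q)) // normG.
Qed.

(** The index of the inertia group divides chi_i(1), which is prime to q by [degG]. As P lies in the
    inertia group, [Sylow_sub_index] applies in G / N, where the normaliser inclusion is known. *)
Lemma constt_inertia_Sylow (i : Iirr G) (j : Iirr N) :
    ~~ (p %| ('chi_i)%R 1%g)%C -> j \in irr_constt ('Res[N] 'chi_i)%R ->
  P \subset 'I[('chi_j)%R] -> N <*> Q \subset 'I[('chi_j)%R].
Proof.
move=> p'i chi_j sPI; have nNG := normal_norm nsNG; pose T := 'I_G[('chi_j)%R]%G.
have [sPG sQG] := (pHall_sub sylP, pHall_sub sylQ).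
have [nNP nNQ] := (subset_trans sPG nNG, subset_trans sQG nNG).
have sTG : T \subset G := Inertia_sub _ _.
have sNT : N \subset T by apply/sub_Inertia/normal_sub.
have sPT : P \subset T by rewrite subsetI sPG.
have q'T : q^'.-nat #|G : T|.
  rewrite p'natE //; apply: contra (degG p'i); rewrite -dvdC_nat => /dvdC_trans-> //.
  exact: index_inertia_dvd_irr1.
rewrite join_subG sub_inertia; apply: subset_trans (subsetIr G _).
rewrite -(quotientSGK nNQ sNT).
apply: (Sylow_sub_index (quotient_separable nsNG sepP) (quotient_separable nsNG sepQ)
  (P := (P / N)%G)) nPQb _ _ _.
- by rewrite quotient_pHall.
- by rewrite quotient_pHall.
- by rewrite quotientS.
- by rewrite quotientS.
by rewrite (pnat_dvd _ q'T) // index_quotient // subIset // nNG.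
Qed.

(* If U = [N, Q] were nontrivial then P = U ><| 'N_P(Q) would have a linear   *)
(* character that is nontrivial on U and trivial on [U, P] and 'N_P(Q); a     *)
(* character of G of p'-degree above it forces Q to fix its restriction to N, *)
(* which is then trivial on U.                                                *)
Lemma norm_Sylow_step_p :
  p != q -> p.-group N -> abelian N -> 'N_G(P) \subset 'N(Q).
Proof.
move=> neq_pq pN abN; have nNG := normal_norm nsNG.
have [[sPG pP p'P] [sQG qQ q'Q]] := (and3P sylP, and3P sylQ).
have [nNP nNQ] := (subset_trans sPG nNG, subset_trans sQG nNG).
have co_p : coprime #|N| #|Q| by rewrite (pnat_coprime pN) // (pi_pnat qQ) // !inE eq_sym.
have sNP : N \subset P by apply: normal_sub_pi'index p'P.
have sylQ1 : q.-Sylow(N <*> Q) Q.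
  by apply: pHall_subl sylQ; rewrite ?joing_subr // join_subG sQG normal_sub.
have nPNQ := norm_Sylow_quotient.
(* If Q centralises N, it is the only Sylow q-subgroup of NQ, which ['N_G(P)] normalises. *)
suffices cNQ : [~: N, Q] = 1.
  have cQN : N \subset 'C(Q) by apply/commG1P.
  have nsQ : Q <| N <*> Q by rewrite /normal joing_subr join_subG normG cents_norm.
  apply/subsetP=> x nPx; apply/normP/eqP; rewrite eqEcard cardJg leqnn andbT.
  have sQx : Q :^ x \subset N <*> Q.
    by rewrite -(normsP nPNQ x nPx) conjSg joing_subr.
  by rewrite (sub_normal_Hall sylQ1) ?pgroupJ.
apply/eqP; apply: contraT => ntU; pose U := [~: N, Q]%G; pose P1 := 'N_P(Q)%G.
have sUN : U \subset N by rewrite commg_subl.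
have sUP := subset_trans sUN sNP.
have nUQ : Q \subset 'N(U) by exact: commg_normr.
have nUN : N \subset 'N(U) by exact: commg_norml.
have defN : U * 'C_N(Q) = N.
  apply/eqP; rewrite eqEsubset mul_subG ?subsetIl //= -quotientSK //.
  rewrite (coprime_quotient_cent sUN nUQ co_p (abelian_sol abN)).
  by rewrite subsetI subxx quotient_cents2r.
have tiUC : 'C_U(Q) = 1 by apply: coprime_abel_cent_TI.
have sP1P : P1 \subset P := subsetIl _ _.
have nNP1 : P1 \subset 'N(N) := subset_trans sP1P nNP.
(* Frattini argument in NQ, which P normalises. *)
have sP_NP1 : P \subset N * P1.
  rewrite -(normC nNP1); apply/subsetP=> x Px.
  have nNQx : (N <*> Q) :^ x = N <*> Q.
    apply: (normsP nPNQ); rewrite inE (subsetP sPG) //=.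
    by rewrite (subsetP (normG P)).
  have sylQx : q.-Sylow(N <*> Q) (Q :^ x)%G by rewrite -nNQx pHallJ2.
  have [y] := Sylow_trans sylQ1 sylQx.
  rewrite /= norm_joinEr // -(normC nNQ) => /mulsgP[u n Qu Nn ->] Qxy.
  rewrite -(mulgKV n x) mem_mulg // inE groupM ?groupV ?(subsetP sNP n) //=.
  by apply/normP; rewrite conjsgM Qxy conjsgM (conjGid Qu) conjsgK.
have sCP1 : 'C_N(Q) \subset P1.
  by rewrite subsetI subIset ?sNP // cents_norm // subsetIr.
have defP : U * P1 = P.
  apply/eqP; rewrite eqEsubset mul_subG //=; apply: subset_trans sP_NP1 _.
  have sNUP1 : N \subset U * P1 by rewrite (subset_trans _ (mulgS U sCP1)) // defN.
  by apply: subset_trans (mulSg P1 sNUP1) _; rewrite -mulgA mulGid.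
(* The commutator of U :&: P1 with Q lies in N :&: Q = 1, so the intersection lies in ['C_U(Q)]. *)
have tiUP1 : U :&: P1 = 1.
  apply/trivgP; rewrite -tiUC subsetI subsetIl (sameP commG1P trivgP).
  rewrite -(coprime_TIg co_p) subsetI commg_subr.
  rewrite (subset_trans (commSg _ (subsetIl _ _))) ?(subset_trans (commSg Q sUN)) //.
  by rewrite subIset // subsetIr orbT.
have nsUP : U <| P.
  rewrite /normal sUP -{1}defP mulG_subG normG /=.
  by apply: normsR; [apply: subset_trans sP1P nNP | apply: subsetIr].
(* V is proper because P is nilpotent; then R = V P1 is normal in P, and P / R is a nontrivial
   abelian quotient of U. *)
pose V := [~: U, P]%G; have ltVU : V \proper U.
  by rewrite (nil_comm_properl (pgroup_nil pP)) // subsetI subxx normal_norm.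
have sVU := proper_sub ltVU.
have nsVP : V <| P.
  by rewrite /normal (subset_trans sVU) // normsR ?normG // normal_norm.
pose R := (V <*> P1)%G.
have sRP : R \subset P by rewrite join_subG (normal_sub nsVP).
have nsRP : R <| P.
  rewrite /normal sRP -{1}defP mulG_subG -commg_subr.
  rewrite (subset_trans (commgS U sRP)) ?joing_subl //=.
  by rewrite (subset_trans (joing_subr V P1)) // normG.
have not_sPR : P / R != 1.
  apply: contraNneq (proper_subn ltVU) => PR1.
  have sPR : P \subset R by rewrite -quotient_sub1 ?PR1 // normal_norm.
  have: U \subset V * (U :&: P1).
    rewrite (setIC U) group_modl // subsetI subxx andbT -norm_joinEr ?(subset_trans sUP) //.
    by rewrite (subset_trans sP1P) ?normal_norm.
  by rewrite tiUP1 mulg1.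
have abPR : abelian (P / R).
  rewrite -defP quotientMl ?(subset_trans sUP) ?normal_norm //.
  have -> : P1 / R = 1 by apply: quotientS1; apply: joing_subr.
  by rewrite mulg1 quotient_abelian // (abelianS sUN).
have [k nz_k] := has_nonprincipal_irr not_sPR.
pose j : Iirr P := mod_Iirr k; pose lam := ('chi_j)%R.
have kerR : R \subset cfker lam by rewrite /lam mod_IirrE // cfker_mod.
have lin_lam : lam \is a linear_char.
  by rewrite /lam mod_IirrE // cfMod_lin_char //; apply/char_abelianP.
have [||i chi_j p'i] := @exists_p'irr_over p gT G P j p_pr sPG.
- by rewrite -p'natE.
- by rewrite (lin_char1 lin_lam) (dvdC_nat p 1) dvdn1 neq_ltn prime_gt1 ?orbT.
have lin_th : ('Res[N] lam)%R \is a linear_char by apply: cfRes_lin_char.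
have /irrP[l Dl] := lin_char_irr lin_th.
have chi_l : l \in irr_constt ('Res[N] 'chi_i)%R.
  rewrite -(cfResRes _ sNP sPG).
  have Nchi : ('Res[P] 'chi_i)%R \is a character by rewrite cfRes_char ?irr_char.
  apply: (constt_Res_trans Nchi chi_j).
  by rewrite -/lam Dl irr_consttE cfdot_irr eqxx oner_eq0.
have sPI : P \subset 'I[('chi_l)%R].
  rewrite -Dl; have := @sub_inertia_Res gT P P N lam nNP.
  by rewrite (setIidPl (sub_inertia lam)) subsetI => /andP[].
have := constt_inertia_Sylow p'i chi_l sPI; rewrite join_subG => /andP[_ sQI].
have kerU : U \subset cfker ('chi_l)%R.
  rewrite gen_subG; apply/subsetP=> _ /imset2P[n y Nn Qy ->].
  have Nny : n ^ y \in N by rewrite memJ_norm ?(subsetP nNQ).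
  rewrite /= cfkerEirr inE commgEl -Dl (lin_charM lin_th) ?groupV //.
  rewrite (lin_charV lin_th) // Dl (inertia_valJ _ (subsetP sQI y Qy)) -Dl.
  by rewrite mulVf ?lin_char_neq0 // (lin_char1 lin_th).
case/negP: nz_k; rewrite -(mod_Iirr_eq0 _ nsRP) -subGcfker.
have: U * P1 \subset cfker lam.
  rewrite mulG_subG (subset_trans (joing_subr V P1) kerR) andbT.
  apply/subsetP=> u Uu; have Nu := subsetP sUN u Uu.
  by have := subsetP kerU u Uu; rewrite /lam /= !cfkerEirr !inE -Dl !cfResE.
by rewrite defP.
Qed.

End InductionStep.

(** Q need not be P-invariant, but the p'-group NQ has a P-invariant Sylow q-subgroup Q1.
    P-invariant characters of N extend to NP and lie under p'-degree characters of G, so Q1 fixes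
    them and ['C_N(P)] centralises Q1. For x in ['N_G(P)], Q1 and Q1^x are conjugate under
    ['C_NQ(P)], and this forces them to be equal. *)
Lemma norm_Sylow_step_p' (p q : nat) (gT : finGroupType) (G N P Q : {group gT}) :
    prime p -> prime q -> p_separable p G -> p_separable q G ->
    p'irr_are_q' p q G -> N <| G -> p.-Sylow(G) P -> q.-Sylow(G) Q ->
    'N_(G / N)(P / N) \subset 'N(Q / N) ->
    p != q -> p^'.-group N -> q^'.-group N ->
  exists2 Q1 : {group gT}, q.-Sylow(G) Q1 & 'N_G(P) \subset 'N(Q1).
Proof.
move=> p_pr q_pr sepP sepQ degG nsNG sylP sylQ nPQb neq_pq p'N q'N.
have nNG := normal_norm nsNG.
have [[sPG pP p'P] [sQG qQ q'Q]] := (and3P sylP, and3P sylQ).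
have [nNP nNQ] := (subset_trans sPG nNG, subset_trans sQG nNG).
have nPNQ := norm_Sylow_quotient nsNG sylQ nPQb.
set NQ := (N <*> Q)%G; have sNQG : NQ \subset G by rewrite join_subG normal_sub.
have nsN_NQ : N <| NQ by rewrite /normal joing_subl join_subG normG.
have nNQP : P \subset 'N(NQ) by rewrite (subset_trans _ nPNQ) // subsetI sPG normG.
have p'NQ : p^'.-group NQ.
  rewrite /NQ /= norm_joinEr // pgroupM p'N (pi_pgroup qQ) // !inE eq_sym.
  by rewrite neq_pq.
have coNQP : coprime #|NQ| #|P| by rewrite coprime_sym (pnat_coprime pP).
have solP := pgroup_sol pP.
have [Q1 sylQ1 nQ1P] := sol_coprime_Sylow_exists q solP nNQP coNQP.
have [sQ1 qQ1 _] := and3P sylQ1.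
have sylQN : q.-Sylow(NQ) Q by apply: pHall_subl sylQ; rewrite ?joing_subr.
have sylQ1G : q.-Sylow(G) Q1.
  rewrite pHallE (subset_trans sQ1) //=.
  by rewrite (card_Hall sylQ1) -(card_Hall sylQN) (card_Hall sylQ).
exists Q1 => //.
have nNQ1 : Q1 \subset 'N(N) := subset_trans sQ1 (normal_norm nsN_NQ).
have defNQ : NQ = Q1 * N :> {set gT}.
  apply/eqP; rewrite eqEsubset mul_subG ?joing_subl // andbT.
  rewrite (normC nNQ1) -quotientSK ?normal_norm //.
  have qNQb : q.-group (NQ / N) by rewrite /= quotientYidl // quotient_pgroup.
  by rewrite (pHall_id (quotient_pHall nNQ1 sylQ1) qNQb).
have inv_irr : invariant_irr N P \subset invariant_irr N Q1.
  apply/subsetP=> j; rewrite !inE => sPI; pose S := (N <*> P)%G.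
  have sSG : S \subset G by rewrite join_subG normal_sub.
  have nsNS : N <| S by rewrite /normal joing_subl join_subG normG.
  have pSN : p.-group (S / N) by rewrite /= quotientYidl // quotient_pgroup.
  have [n Dn p'n] := irr1_p'group j p_pr p'N.
  (* The extension exists since |S : N| is a power of p, while the degree and determinantal order of
     chi_j are prime to p. *)
  have [||| c [Dc _ _]] := @extend_solvable_coprime_irr _ S N j nsNS.
  - exact: pgroup_sol pSN.
  - by rewrite join_subG sub_inertia.
  - rewrite coprimeMr -card_quotient ?normal_norm // Dn natrK.
    rewrite (coprime_dvdr (cfDet_order_dvdG _)) ?(pnat_coprime pSN) //=.
    by rewrite p'natE.
  have c1 : ('chi_c 1%g = 'chi_j 1%g)%R by rewrite -Dc cfRes1.
  have [|| i chi_c p'i] := @exists_p'irr_over p gT G S c p_pr sSG.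
  - by rewrite -p'natE // (pnat_dvd _ p'P) // indexgS ?joing_subr.
  - by rewrite c1 Dn dvdC_nat.
  have chi_j : j \in irr_constt ('Res[N] 'chi_i)%R.
    rewrite -(cfResRes _ (joing_subl N P) sSG).
    have Nchi : ('Res[S] 'chi_i)%R \is a character by rewrite cfRes_char ?irr_char.
    apply: (constt_Res_trans Nchi chi_c).
    by rewrite Dc irr_consttE cfdot_irr eqxx oner_eq0.
  apply: subset_trans sQ1 _.
  exact: (constt_inertia_Sylow q_pr sepP sepQ degG nsNG sylP sylQ nPQb p'i chi_j sPI).
have cPQ1 : 'C_N(P) \subset 'C(Q1).
  exact: cent_sub_invariant_irr p_pr q_pr pP qQ1 p'N q'N nNP nNQ1 nQ1P inv_irr.
apply/subsetP=> x /setIP[Gx nPx].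
have sylQ1x : q.-Sylow(NQ) (Q1 :^ x)%G.
  have NQx : NQ :^ x = NQ by apply: (normsP nPNQ); rewrite inE Gx.
  by rewrite -NQx pHallJ2.
have nQ1xP : P \subset 'N(Q1 :^ x) by rewrite normJ -(normP nPx) conjSg.
have := sol_coprime_Sylow_trans q solP nNQP coNQP.
move/atransP2=> /(_ Q1 (Q1 :^ x)%G); rewrite !inE sylQ1 sylQ1x nQ1P nQ1xP.
case=> // c /setIP[NQc cPc] /(congr1 val) /= defQ1x.
have: c \in Q1 * N by rewrite -defNQ.
case/mulsgP=> a n Qa Nn Dc; rewrite {c NQc}Dc in cPc defQ1x.
(* P normalises both factors of the product Q1 N, and these meet trivially, so it fixes each
   component of a n. *)
have cPn : n \in 'C(P).
  apply/centP=> u Pu; apply/commgP/conjg_fixP.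
  have: (a * n) ^ u = a * n by apply/conjg_fixP/commgP/(centP cPc).
  rewrite conjMg => eq_an.
  have tiQN : Q1 :&: N = 1 by rewrite coprime_TIg // (pnat_coprime qQ1).
  have Qau : a ^ u \in Q1 by rewrite memJ_norm ?(subsetP nQ1P).
  have Nnu : n ^ u \in N by rewrite memJ_norm ?(subsetP nNP).
  have: (a ^ u)^-1 * a \in Q1 :&: N.
    rewrite inE groupM ?groupV //=.
    have -> : (a ^ u)^-1 * a = n ^ u * n^-1.
      by apply: (mulgI (a ^ u)); rewrite mulKVg mulgA eq_an mulgK.
    by rewrite groupM ?groupV.
  rewrite tiQN => /set1gP/eqP; rewrite -eq_mulVg1 => /eqP eq_a.
  by apply: (mulgI a); rewrite -eq_an eq_a.
have cQn : n \in 'C(Q1) by apply: (subsetP cPQ1); rewrite inE Nn.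
rewrite defQ1x conjsgM (conjGid Qa).
by rewrite (normP (subsetP (cent_sub _) n cQn)).
Qed.

(* The induction needs the full normaliser of P: this is what allows          *)
(* Sylow_sub_index to place the given Q in the inertia groups.                *)
Theorem norm_Sylow_p'irr_q' (p q : nat) (gT : finGroupType) (G : {group gT}) :
    prime p -> prime q -> p != q -> p_separable p G -> p_separable q G ->
    p'irr_are_q' p q G ->
  exists P Q : {group gT}, [/\ p.-Sylow(G) P, q.-Sylow(G) Q & 'N_G(P) \subset 'N(Q)].
Proof.
move=> p_pr q_pr neq_pq; have [n] := ubnP #|G|; elim: n => // n IHn in gT G *.
rewrite ltnS => leGn sepP sepQ degG.
have [G1 | ntG] := eqVneq G 1%G.
  have [[P sylP] [Q sylQ]] := (Sylow_exists p G, Sylow_exists q G).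
  exists P, Q; split=> //; apply: subset_trans (subsetIl _ _) _.
  by rewrite G1 sub1G.
have [N minN sNG] := minnormal_exists ntG (normG G).
have [ntN nNG] := andP (mingroupp minN).
have nsNG : N <| G by apply/andP.
have [||||Pb [Qb [sylPb sylQb nPQb]]] := IHn _ (G / N)%G.
- by apply: leq_trans leGn; rewrite ltn_quotient.
- exact: quotient_separable.
- exact: quotient_separable.
- exact: p'irr_are_q'_quotient.
have [P sylP defPb] := Sylow_lift nsNG sylPb.
have [Q sylQ defQb] := Sylow_lift nsNG sylQb.
rewrite -defPb -defQb in nPQb.
have [qN | not_qN] := boolP (q.-group N).
  have sNQ : N \subset Q.
    by apply: (normal_sub_pi'index nsNG (pHall_sub sylQ) qN); case/and3P: sylQ.
  exists P, Q; split=> //.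
  by have := norm_Sylow_quotient nsNG sylQ nPQb; rewrite (joing_idPr sNQ).
have q'N : q^'.-group N.
  by have := minnormal_separable sepQ minN sNG; rewrite (negPf not_qN).
have /orP[pN | p'N] := minnormal_separable sepP minN sNG.
  exists P, Q; split=> //; apply: (@norm_Sylow_step_p p q) nPQb _ _ _ => //.
  have [_ _ /is_abelemP[r _ /abelem_abelian]] :=
    minnormal_solvable minN (subxx N) (pgroup_sol pN).
  by [].
have [Q1 sylQ1 nPQ1] := norm_Sylow_step_p' p_pr q_pr sepP sepQ degG nsNG
  sylP sylQ nPQb neq_pq p'N q'N.
by exists P, Q1.
Qed.

(** * Characters of p'-degree in the principal block *)

Local Open Scope ring_scope.

Section MaximalIdeal.

Variables (p : nat) (M : {pred algint}).
Hypotheses (p_pr : prime p) (maxM : maximal_ideal_over p M).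

Lemma maximal_idealD x y : x \in M -> y \in M -> x + y \in M.
Proof. by case: maxM => [[[_ _ MI] _] _] Mx My; rewrite -[x]mul1r MI. Qed.

Lemma maximal_ideal0 : 0 \in M.
Proof. by case: maxM => [[[]]]. Qed.

Lemma maximal_idealMl a x : x \in M -> a * x \in M.
Proof.
by case: maxM => [[[M0 _ MI] _] _] Mx; rewrite -[a * x]addr0 MI.
Qed.

(** Maximal ideals are prime: if a is outside M, the ideal generated by M and a contains 1. *)
Lemma maximal_idealM a b : a * b \in M -> a \notin M -> b \in M.
Proof.
case: maxM => [[[M0 M1 MI] max_] _] Mab not_Ma.
pose I : {pred algint} := fun z => boolp.asbool (exists r m, m \in M /\ z = r * a + m).
have IP z : reflect (exists r m, m \in M /\ z = r * a + m) (z \in I).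
  exact: boolp.asboolP.
have sMI : {subset M <= I} by move=> m Mm; apply/IP; exists 0, m; rewrite mul0r add0r.
have [/IP[r [m [Mm D1]]] | notI1] := boolP (1 \in I).
  by rewrite -[b]mul1r D1 mulrDl -mulrA MI // mulrC maximal_idealMl.
case/negP: not_Ma; apply: (max_ I) => //; last first.
  by apply/IP; exists 1, 0; rewrite mul1r addr0.
split=> // [|c _ _ /IP[r [m [Mm ->]]] /IP[r' [m' [Mm' ->]]]]; first exact: sMI.
apply/IP; exists (c * r + r'), (c * m + m'); split; first exact: MI.
by rewrite mulrDr mulrDl mulrA addrACA.
Qed.

Lemma maximal_ideal_exp x n : x ^+ n.+1 \in M -> x \in M.
Proof.
elim: n => [|n IHn]; first by rewrite expr1.
rewrite exprS => Mx; have [// | notMx] := boolP (x \in M).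
by rewrite -(negPf notMx) IHn ?(maximal_idealM Mx).
Qed.

Lemma maximal_ideal_nat n : (n%:R \in M) = (p %| n)%N.
Proof.
have [[[M0 M1 MI] _] Mp] := maxM.
apply/idP/idP=> [Mn | /dvdnP[m ->]]; last by rewrite natrM maximal_idealMl.
apply: contraR M1 => p'n.
have n_gt0 : (0 < n)%N by rewrite lt0n; apply: contraNneq p'n => ->.
have [u v Duv _] := egcdnP p n_gt0.
have co_np : gcdn n p = 1%N by apply/eqP; rewrite [_ == _]coprime_sym prime_coprime.
have -> : 1 = u%:R * n%:R + (- v%:R * p%:R) :> algint.
  by rewrite mulNr -!natrM Duv co_np natrD addrC addKr.
by rewrite MI // maximal_idealMl.
Qed.

(** Modulo M the p-th power of x - 1 is x^p - 1, the middle binomial coefficients being divisible by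
    p; M is prime. *)
Lemma maximal_ideal_unity x k : x ^+ (p ^ k) = 1 -> x - 1 \in M.
Proof.
have [[[M0 M1 MI] _] Mp] := maxM.
elim: k x => [|k IHk] x; first by rewrite expr1 => ->; rewrite subrr.
rewrite expnS exprM => /IHk; set t := x - 1 => Mxp.
have p_gt0 := prime_gt0 p_pr; apply: (@maximal_ideal_exp t p.-1); rewrite prednK //.
have Dx : x = 1 + t by rewrite addrC subrK.
have Dxp : x ^+ p = 1 + t ^+ p + \sum_(i < p.-1) t ^+ i.+1 *+ 'C(p, i.+1).
  have binom m : (1 + t) ^+ m.+1
      = 1 + t ^+ m.+1 + \sum_(i < m) t ^+ i.+1 *+ 'C(m.+1, i.+1).
    rewrite exprDn big_ord_recr big_ord_recl /=.
    rewrite subn0 expr1n mul1r expr0 bin0 subnn mul1r binn addrAC; congr (_ + _ + _).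
    by apply: eq_bigr => i _; rewrite expr1n mul1r.
  by have := binom p.-1; rewrite prednK // -Dx.
have Msum : \sum_(i < p.-1) t ^+ i.+1 *+ 'C(p, i.+1) \in M.
  elim/big_rec: _ => // i y _; apply: maximal_idealD.
  rewrite -mulr_natr maximal_idealMl // maximal_ideal_nat prime_dvd_bin //=.
  by rewrite -ltn_predRL.
have -> : t ^+ p = (x ^+ p - 1) + (-1) * \sum_(i < p.-1) t ^+ i.+1 *+ 'C(p, i.+1).
  by rewrite Dxp mulN1r; ring.
by rewrite maximal_idealD ?maximal_idealMl.
Qed.

End MaximalIdeal.

(** The eigenvalues of [x] are roots of unity of p-power order, each congruent to 1 modulo M. *)
Lemma irr_p_elt_congr (p : nat) (M : {pred algint}) (gT : finGroupType)
    (G : {group gT}) (i : Iirr G) (x : gT) (k : nat) (z : algint) :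
    prime p -> maximal_ideal_over p M ->
    x \in G -> (x ^+ (p ^ k) = 1)%g -> val z = 'chi_i x - 'chi_i 1%g -> z \in M.
Proof.
move=> p_pr maxM Gx xp1; rewrite -irrRepr.
have [e [_ [e1 _] [-> _] _]] := repr_rsim_diag 'Chi_i Gx.
have Ae j : e 0 j \in Aint by apply: (@Aint_unity_root #[x]) => //; apply/unity_rootP.
rewrite cfRepr1 => Dz.
have -> : z = \sum_j (AlgInt (Ae j) - 1).
  apply: val_inj; rewrite Dz rmorph_sum.
  rewrite [RHS](eq_bigr (fun j => e 0 j - 1)) => [|j _]; last by rewrite rmorphB rmorph1.
  by rewrite sumrB sumr_const card_ord.
elim/big_rec: _ => [|j y _ My]; first exact: maximal_ideal0 maxM.
apply: (maximal_idealD maxM) My; apply: (@maximal_ideal_unity p M p_pr maxM _ k).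
apply: val_inj; rewrite rmorphXn rmorph1 /=.
have /dvdnP[m ->] : (#[x] %| p ^ k)%N by rewrite order_dvdn xp1.
by rewrite mulnC exprM e1 expr1n.
Qed.

Section PrincipalBlock.

Variables (p : nat) (M : {pred algint}) (gT : finGroupType) (G : {group gT}).
Hypotheses (p_pr : prime p) (maxM : maximal_ideal_over p M).

Lemma omegaE (i : Iirr G) k :
  val (omega i k) = #|enum_val k|%:R * 'chi_i (repr (enum_val k)) / 'chi_i 1%g.
Proof.
have /repr_classesP[Gx Dk] := enum_valP k.
rewrite /= (@gring_mode_class_sum_eq _ _ i k (repr (enum_val k))) -?Dk //.
by rewrite {2}Dk class_refl.
Qed.

(** If N is not in the kernel, chi_i sums to 0 over N. Adding the block congruences over the classes
    inside N then gives -|N| in M, although p does not divide |N|. *)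
Lemma principal_block_cfker (N : {group gT}) (i : Iirr G) :
    N <| G -> p^'.-group N -> i \in principal_block G M -> N \subset cfker 'chi_i.
Proof.
move=> nsNG p'N; rewrite inE => /forallP Bi; apply: contraT => not_kerN.
have sNG := normal_sub nsNG.
pose d (k : 'I_#|classes G|) := if enum_val k \subset N then omega i k - omega 0 k else 0.
have Md : \sum_k d k \in M.
  elim/big_rec: _ => [|k y _ My]; first exact: maximal_ideal0 maxM.
  apply: (maximal_idealD maxM) My; rewrite /d; case: ifP => // _.
  exact: maximal_ideal0 maxM.
pose F x := if x \in N then 'chi_i x / 'chi_i 1%g - 1 else 0.
have valF : val (\sum_k d k) = \sum_(x in G) F x.
  rewrite rmorph_sum sum_by_classes => [|x y Gx Gy]; last first.
    by rewrite /F memJ_norm ?(subsetP (normal_norm nsNG)) // cfunJ.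
  rewrite (big_enum_val (fun K : {set gT} => #|K|%:R * F (repr K))); apply: eq_bigr => k _.
  have /repr_classesP[Gx Dk] := enum_valP k.
  have -> : d k = if repr (enum_val k) \in N then omega i k - omega 0 k else 0.
    by rewrite /d {1}Dk class_sub_norm // normal_norm.
  rewrite /F; case: ifP => _; last by rewrite mulr0 rmorph0.
  rewrite rmorphB -[LHS]/(val (omega i k) - val (omega 0 k)) !omegaE.
  rewrite irr0 !cfun1E Gx group1 divr1 mulr1 mulrBr mulr1.
  by rewrite mulrA.
have sumN : \sum_(x in N) 'chi_i x = 0.
  have: '['Res[N] 'chi_i, 'chi_0] = 0.
    apply/eqP; apply: contraNT not_kerN => chi_0.
    by apply: constt0_Res_cfker; rewrite ?irr_consttE.
  rewrite cfdotE => /(canRL (mulVKf (neq0CG N))); rewrite mulr0 => sum0.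
  rewrite -[RHS]sum0; apply: eq_bigr => x Nx.
  by rewrite cfResE // irr0 cfun1E Nx rmorph1 mulr1.
have Dsum : \sum_k d k = -1 * #|N|%:R.
  apply: val_inj; rewrite valF rmorphM rmorphN rmorph1 rmorph_nat.
  rewrite -big_mkcondr /= (eq_bigl (mem N)) => [|x]; last first.
    by rewrite andb_idl //; apply: (subsetP sNG).
  by rewrite sumrB -mulr_suml sumN mul0r sumr_const sub0r mulN1r.
have: (p %| #|N|)%N.
  rewrite -(maximal_ideal_nat p_pr maxM).
  have -> : #|N|%:R = -1 * \sum_k d k by rewrite Dsum mulrA mulrNN mulr1 mul1r.
  by rewrite (maximal_idealMl maxM).
by rewrite (negPf (prime_p'group p'N p_pr)).
Qed.

(** Multiplied by chi_i(1), which is outside the prime ideal M, the difference of central characters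
    at a class K of x is |K| (chi_i(x) - chi_i(1)). Either p divides |K|, or Hall-Higman makes x a
    p-element modulo O_p'(G) and [irr_p_elt_congr] applies. *)
Lemma mem_principal_block (i : Iirr G) :
    p_separable p G -> ~~ (p %| 'chi_i 1%g)%C -> 'O_p^'(G) \subset cfker 'chi_i ->
  i \in principal_block G M.
Proof.
move=> sepG p'i kerN; rewrite inE; apply/forallP=> k.
set N := 'O_p^'(G)%G in kerN; have nsNG : N <| G := pcore_normal _ _.
have [n Dn] := natrP (Cnat_irr1 i); rewrite Dn dvdC_nat in p'i.
have n_neq0 : n%:R != 0 :> algC by rewrite -Dn irr1_neq0.
apply: (maximal_idealM maxM (a := n%:R)); last first.
  by rewrite (maximal_ideal_nat p_pr maxM).
have /repr_classesP[Gx Dk] := enum_valP k; set x := repr _ in Gx Dk.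
have Az : 'chi_i x - 'chi_i 1%g \in Aint by rewrite rpredB ?Aint_irr.
have -> : n%:R * (omega i k - omega 0 k) = AlgInt Az * #|enum_val k|%:R.
  apply: val_inj; rewrite !rmorphM rmorphB !rmorph_nat.
  rewrite -[LHS]/(n%:R * (val (omega i k) - val (omega 0 k))) !omegaE -/x irr0 !cfun1E.
  by rewrite Gx group1 /= Dn; field.
have [p_k | p'k] := boolP (p %| #|enum_val k|)%N.
  by rewrite (maximal_idealMl maxM) // (maximal_ideal_nat p_pr maxM).
rewrite mulrC (maximal_idealMl maxM) //.
have nNx : x \in 'N(N) by apply: subsetP Gx; apply: normal_norm.
have : coset N x \in 'O_p(G / N)%g.
  apply: (subsetP (separable_cent_pcore (quotient_separable nsNG sepG) _)).
    exact: trivg_pcore_quotient.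
  have [S sylS] := Sylow_exists p 'C_G[x].
  have [sSC pS p'S] := and3P sylS.
  have sylSG : p.-Sylow(G) S.
    rewrite pHallE (subset_trans sSC) ?subsetIl //= (card_Hall sylS).
    have := Lagrange (subsetIl G 'C[x]); rewrite index_cent1 -Dk => <-.
    rewrite partnM //; last by rewrite Dk; apply/card_gt0P; exists x; apply: class_refl.
    by rewrite [(#|enum_val k|`_p)%N]part_p'nat ?muln1 ?p'natE.
  rewrite inE mem_quotient //=.
  have sylSN : p.-Sylow(G / N)%g (S / N)%g.
    by rewrite quotient_pHall // (subset_trans (pHall_sub sylSG)) ?normal_norm.
  apply: (subsetP (centS (pcore_sub_Hall sylSN))).
  apply/centP=> _ /morphimP[y nNy Sy ->].
  have /setIP[_ /cent1P cyx] := subsetP sSC y Sy.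
  by rewrite /commute -!morphM // cyx.
move/(mem_p_elt (pcore_pgroup _ _))/p_natP=> [m om].
pose ib := quo_Iirr N i.
have chiE y : y \in G -> 'chi_i y = 'chi_ib (coset N y).
  by move=> Gy; rewrite /ib quo_IirrE // cfQuoE.
apply: (@irr_p_elt_congr p M _ _ ib (coset N x) m) => //.
- exact: mem_quotient.
- by rewrite -om expg_order.
by rewrite /= !chiE // morph1.
Qed.

End PrincipalBlock.

Local Open Scope group_scope.
Local Open Scope ring_scope.

(** * From degree conditions to commuting Sylow subgroups *)

Lemma p'group_of_cent_pcore (p q : nat) (gT : finGroupType) (H Q : {group gT}) :
    prime q -> p != q -> p_separable p H -> 'O_p^'(H)%g = 1%g -> q.-Sylow(H) Q ->
  Q \subset 'C('O_p(H)) -> q^'.-group H.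
Proof.
move=> q_pr neq_pq sepH Op'1 sylQ cQO; have [sQH qQ _] := and3P sylQ.
have pQ : p.-group Q.
  apply: pgroupS (pcore_pgroup p H); apply: subset_trans (separable_cent_pcore sepH Op'1).
  by rewrite subsetI sQH.
have Q1 : Q :=: 1%g.
  apply: card1_trivg; apply: (pnat_1 qQ); apply: (pi_p'nat pQ).
  by rewrite !inE eq_sym.
by rewrite /pgroup -partn_eq1 // -(card_Hall sylQ) Q1 cards1.
Qed.

(** In the quotient, O_p lies in P and so normalises Q, while Q normalises O_p; having coprime
    orders they commute, and Hall-Higman forces Q = 1. *)
Lemma q'group_quotient_core (p q : nat) (gT : finGroupType) (G : {group gT}) :
    prime p -> prime q -> p != q -> p_separable p G -> p_separable q G ->
    p'irr_are_q' p q (G / 'O_p^'(G))%G -> q^'.-group (G / 'O_p^'(G)).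
Proof.
move=> p_pr q_pr neq_pq sepP sepQ degG.
have nsNG : 'O_p^'(G) <| G := pcore_normal _ _.
have [sepPb sepQb] := (quotient_separable nsNG sepP, quotient_separable nsNG sepQ).
have [P [Q [sylP sylQ nPQ]]] := norm_Sylow_p'irr_q' p_pr q_pr neq_pq sepPb sepQb degG.
have [[sPG _ _] [sQG qQ _]] := (and3P sylP, and3P sylQ).
apply: (p'group_of_cent_pcore q_pr neq_pq sepPb (trivg_pcore_quotient _ _) sylQ).
rewrite centsC; apply/commG1P/trivgP; set V := 'O_p(_)%g.
have nVQ : Q \subset 'N(V) by rewrite (subset_trans sQG) // normal_norm ?pcore_normal.
have nQV : V \subset 'N(Q).
  rewrite (subset_trans (pcore_sub_Hall sylP)) // (subset_trans _ nPQ) //.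
  by rewrite subsetI sPG normG.
have <- : V :&: Q = 1%g.
  rewrite coprime_TIg // (pnat_coprime (pcore_pgroup p _)) // (pi_pnat qQ) //.
  by rewrite !inE eq_sym.
by rewrite subsetI commg_subl nVQ commg_subr.
Qed.

Lemma commuting_Sylows_quotient (p q : nat) (gT : finGroupType) (G P Q : {group gT}) :
    prime q -> p != q -> p_separable p G -> p.-Sylow(G) P -> q.-Sylow(G) Q ->
    Q \subset 'C(P) -> q^'.-group (G / 'O_p^'(G)).
Proof.
move=> q_pr neq_pq sepP sylP sylQ cQP.
have nsNG : 'O_p^'(G) <| G := pcore_normal _ _.
have nNG := normal_norm nsNG.
have nNP := subset_trans (pHall_sub sylP) nNG.
have nNQ := subset_trans (pHall_sub sylQ) nNG.
apply: (p'group_of_cent_pcore (Q := (Q / _)%G) q_pr neq_pq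
  (quotient_separable nsNG sepP) (trivg_pcore_quotient _ _)).
  by rewrite quotient_pHall.
apply: subset_trans (quotient_cents _ cQP) _.
by apply/centS/pcore_sub_Hall; rewrite quotient_pHall.
Qed.

Lemma pi_sub_pi'quotient (pi : nat_pred) (gT : finGroupType) (G N K : {group gT}) :
    N <| G -> K \subset G -> pi.-group K -> pi^'.-group (G / N) -> K \subset N.
Proof.
move=> nsNG sKG piK pi'GN.
rewrite -quotient_sub1 ?(subset_trans sKG) ?normal_norm //.
have KN1 := pnat_1 (quotient_pgroup N piK) (pgroupS (quotientS N sKG) pi'GN).
by rewrite (card1_trivg KN1).
Qed.

(** P acts coprimely on A and so normalises a Sylow q-subgroup Q of A, which is Sylow in G. Since P
    lies in the normal q'-subgroup B, [P, Q] lies in B :&: Q = 1. *)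
Lemma commuting_Sylows_exist (p q : nat) (gT : finGroupType) (G : {group gT}) :
    prime p -> prime q -> q^'.-group (G / 'O_p^'(G)) -> p^'.-group (G / 'O_q^'(G)) ->
  exists P Q : {group gT}, [/\ p.-Sylow(G) P, q.-Sylow(G) Q & Q \subset 'C(P)].
Proof.
move=> p_pr q_pr q'A p'B; set A := 'O_p^'(G)%G in q'A; set B := 'O_q^'(G)%G in p'B.
have [nsAG nsBG] : A <| G /\ B <| G by rewrite !pcore_normal.
have [P sylP] := Sylow_exists p G; have [sPG pP _] := and3P sylP.
have nAP : P \subset 'N(A) by rewrite (subset_trans sPG) ?normal_norm.
have coAP : coprime #|A| #|P| by rewrite coprime_sym (pnat_coprime pP (pcore_pgroup _ _)).
have [Q sylQA nQP] := sol_coprime_Sylow_exists q (pgroup_sol pP) nAP coAP.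
have [sQA qQ _] := and3P sylQA.
have sylQ : q.-Sylow(G) Q.
  rewrite pHallE (subset_trans sQA) ?normal_sub //= (card_Hall sylQA).
  rewrite -(Lagrange (normal_sub nsAG)) -card_quotient ?normal_norm // partnM //.
  by rewrite [(#|(G / A)%g|`_q)%N]part_p'nat ?muln1.
have sPB : P \subset B := pi_sub_pi'quotient nsBG sPG pP p'B.
exists P, Q; split=> //; rewrite centsC; apply/commG1P/trivgP.
have <- : B :&: Q = 1%g.
  by rewrite coprime_TIg // coprime_sym (pnat_coprime qQ (pcore_pgroup _ _)).
rewrite subsetI commg_subr nQP andbT.
apply: subset_trans (commSg Q sPB) _; rewrite commg_subl.
by rewrite (subset_trans (pHall_sub sylQ)) ?normal_norm.
Qed.

(** Take a p'-degree character above a nontrivial linear character of P. *)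
Lemma exists_p'irr_Sylow_ker (p : nat) (gT : finGroupType) (G P : {group gT}) :
    prime p -> p.-Sylow(G) P -> P :!=: 1%g ->
  exists2 i : Iirr G, ~~ (p %| 'chi_i 1%g)%C & ~~ (P \subset cfker 'chi_i).
Proof.
move=> p_pr sylP ntP; have [sPG pP p'P] := and3P sylP.
have nsP'P : P^`(1)%g <| P := der_normal 1 P.
have ntPP' : (P / P^`(1))%g != 1%g.
  rewrite -subG1 quotient_sub1 ?normal_norm //.
  have := sol_der1_proper (pgroup_sol pP) (subxx P) ntP.
  by rewrite properE => /andP[].
have [k nz_k] := has_nonprincipal_irr ntPP'.
have lin_j : 'chi_(mod_Iirr k) \is a linear_char.
  by rewrite mod_IirrE // cfMod_lin_char //; apply/char_abelianP/sub_der1_abelian.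
have [||i chi_j p'i] := @exists_p'irr_over p gT G P (mod_Iirr k) p_pr sPG.
- by rewrite -p'natE.
- by rewrite (lin_char1 lin_j) (dvdC_nat p 1) dvdn1 neq_ltn prime_gt1 ?orbT.
exists i => //; apply: contra nz_k => kerP.
move: chi_j; rewrite cfRes_sub_ker // irr_consttE cfdotZl -irr0 cfdot_irr.
rewrite mulf_eq0 negb_or pnatr_eq0 eqb0 negbK => /andP[_ /eqP j0].
by rewrite -(mod_Iirr_eq0 _ nsP'P) -j0.
Qed.

Lemma p'irr_quotient_core (p q : nat) (M : {pred algint}) (gT : finGroupType)
    (G : {group gT}) :
    prime p -> maximal_ideal_over p M -> p_separable p G ->
    (forall i, i \in Irr_p'_principal G p M -> ~~ (q %| 'chi_i 1%g)%C) ->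
  p'irr_are_q' p q (G / 'O_p^'(G))%G.
Proof.
move=> p_pr maxM sepP degG i p'i; have nsNG : 'O_p^'(G)%g <| G := pcore_normal _ _.
have := degG (mod_Iirr i); rewrite inE (mod_IirrE _ nsNG) cfMod1 //; apply.
rewrite p'i andbT (mem_principal_block p_pr maxM) //.
  by rewrite mod_IirrE // cfMod1.
by rewrite mod_IirrE // cfker_mod.
Qed.

Lemma Irr_p'_principal_quotient (p q : nat) (M : {pred algint}) (gT : finGroupType)
    (G : {group gT}) (i : Iirr G) :
    prime p -> prime q -> maximal_ideal_over p M -> q^'.-group (G / 'O_p^'(G)) ->
    i \in Irr_p'_principal G p M ->
  ~~ (q %| 'chi_i 1%g)%C.
Proof.
move=> p_pr q_pr maxM q'G; rewrite inE => /andP[Bi _].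
have nsNG : 'O_p^'(G)%g <| G := pcore_normal _ _.
have kerN := principal_block_cfker p_pr maxM nsNG (pcore_pgroup _ _) Bi.
have [n Dn q'n] := irr1_p'group (quo_Iirr 'O_p^'(G) i) q_pr q'G.
by rewrite -(cfQuo1 'O_p^'(G)) -quo_IirrE // Dn dvdC_nat.
Qed.

Theorem theoremE (gT : finGroupType) (G : {group gT}) (p q : nat)
  (Mp Mq : {pred algint})
  (hp : prime p) (hq : prime q)
  (hMp : maximal_ideal_over p Mp) (hMq : maximal_ideal_over q Mq)
  (hGp : p_solvable G p) (hGq : p_solvable G q) :
  ((p %| #|G|)%N -> (q %| #|G|)%N ->
   Irr_p'_principal G p Mp = Irr_p'_principal G q Mq -> p = q) /\
  (p <> q ->
   ((forall i : Iirr G, i \in Irr_p'_principal G p Mp ->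
       ~~ (q %| 'chi_i 1%g)%C) /\
    (forall i : Iirr G, i \in Irr_p'_principal G q Mq ->
       ~~ (p %| 'chi_i 1%g)%C))
   <->
   exists P Q : {group gT},
     [/\ p.-Sylow(G) P, q.-Sylow(G) Q
       & forall x y : gT, x \in P -> y \in Q -> (x * y = y * x)%g]).
Proof.
have [sepP sepQ] := (p_solvable_separable hGp, p_solvable_separable hGq).
have q'quo : p != q ->
    (forall i, i \in Irr_p'_principal G p Mp -> ~~ (q %| 'chi_i 1%g)%C) ->
    q^'.-group (G / 'O_p^'(G)).
  move=> neq_pq degG; apply: q'group_quotient_core => //.
  exact: p'irr_quotient_core hp hMp sepP degG.
have p'quo : p != q ->
    (forall i, i \in Irr_p'_principal G q Mq -> ~~ (p %| 'chi_i 1%g)%C) ->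
    p^'.-group (G / 'O_q^'(G)).
  move=> neq_pq degG; apply: q'group_quotient_core; rewrite // 1?eq_sym //.
  exact: p'irr_quotient_core hq hMq sepQ degG.
split=> [p_dv_G q_dv_G eq_irr | /eqP neq_pq].
  apply/eqP; apply: contraT => neq_pq.
  (* By the assumed equality, the characters in Irr_q'(B_q(G)) have p'-degree. Hence P lies in
     O_q'(G), the common kernel of a contradiction with a character nontrivial on P. *)
  have p'B : p^'.-group (G / 'O_q^'(G)).
    by apply: p'quo => // i; rewrite -eq_irr inE => /andP[].
  have [P sylP] := Sylow_exists p G; have [sPG pP _] := and3P sylP.
  have nsAG : 'O_p^'(G)%g <| G := pcore_normal _ _.
  have nAP : P \subset 'N('O_p^'(G)) by rewrite (subset_trans sPG) ?normal_norm.
  have sylPA : p.-Sylow(G / 'O_p^'(G)) (P / 'O_p^'(G))%G by rewrite quotient_pHall.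
  have ntPA : (P / 'O_p^'(G))%G :!=: 1%g.
    apply: contraTneq p_dv_G => PA1; rewrite -p'natE // -partn_eq1 // -(card_Hall sylP).
    have sPA : P \subset 'O_p^'(G) by rewrite -quotient_sub1 //; move: PA1 => /= ->.
    by rewrite (pnat_1 pP (pgroupS sPA (pcore_pgroup _ _))).
  have [k p'k] := exists_p'irr_Sylow_ker hp sylPA ntPA; case/negP.
  have i_p : mod_Iirr k \in Irr_p'_principal G q Mq.
    have p'i : ~~ (p %| 'chi_(mod_Iirr k) 1%g)%C by rewrite mod_IirrE ?cfMod1.
    rewrite -eq_irr; apply/setIdP; split=> //.
    by apply: (mem_principal_block hp hMp sepP) => //; rewrite mod_IirrE ?cfker_mod.
  have [Bi _] := setIdP i_p.
  have kerB := principal_block_cfker hq hMq (pcore_normal _ _) (pcore_pgroup _ _) Bi.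
  have sPB : P \subset 'O_q^'(G).
    by apply: pi_sub_pi'quotient pP p'B; rewrite ?pcore_normal.
  apply/subsetP=> _ /morphimP[x nAx Px ->].
  have := subsetP kerB x (subsetP sPB x Px).
  by rewrite !cfkerEirr !inE mod_IirrE // cfMod1 cfModE // (subsetP sPG).
split=> [[degP degQ] | [P [Q [sylP sylQ cPQ]]]].
  have [P [Q [sylP sylQ cQP]]] :=
    commuting_Sylows_exist hp hq (q'quo neq_pq degP) (p'quo neq_pq degQ).
  exists P, Q; split=> // x y Px Qy; apply/esym.
  exact: (centP (subsetP cQP y Qy)).
have cQP : Q \subset 'C(P).
  by apply/subsetP=> y Qy; apply/centP=> x Px; apply/esym/cPQ.
split=> i; apply: Irr_p'_principal_quotient => //.
  exact: commuting_Sylows_quotient sylP sylQ cQP.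
by apply: commuting_Sylows_quotient sylQ sylP _; rewrite // 1?eq_sym // centsC.
Qed.
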